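(* Let $D$ be a Krull-type domain. Then $\operatorname{Int}(D)$ is a PvMD if and only if $\operatorname{Int}(D_0)$ is a Prüfer domain.
   Context: For an integral domain $D$ with quotient field $K$: $\operatorname{Int}(D)=\{g\in K[X]:g(D)\subseteq D\}$, and for a prime $P$ of $D$, $\operatorname{Int}(D)_P$ denotes the localization of $\operatorname{Int}(D)$ at the multiplicative set $D\setminus P$. For a nonzero fractional ideal $I$: $(D:I)=\{x\in K:xI\subseteq D\}$, $I^v=(D:(D:I))$, $I^t=\bigcup\{J^v:J\subseteq I \text{ finitely generated}\}$; $I$ is a $t$-ideal if $I=(0)$ or $I=I^t$; $t\text{-Spec}(D)$ is the set of prime $t$-ideals; $t$-maximal ideals are $t$-ideals maximal among proper $t$-ideals. $D$ is a PvMD if $D_{\mathfrak m}$ is a valuation domain for all $t$-maximal $\mathfrak m$. $D$ is Krull-type if it is the intersection of a family $\mathcal V$ of valuation overrings each of which is a localization $D_{\mathfrak p}$ at a prime, with $\mathcal V$ locally finite (each nonzero $x\in D$ is a nonunit in only finitely many members of $\mathcal V$). Set $\Lambda_0=\{P\in t\text{-Spec}(D):\operatorname{Int}(D)_P\neq D_P[X]\}$ and $D_0=\bigcap_{P\in\Lambda_0}D_P$ (with $D_0=K$ if $\Lambda_0=\emptyset$). *)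

(* Defs.v *)
From Stdlib Require List.
From HB Require Import structures.
From mathcomp Require Import all_boot all_order all_algebra.
Set Implicit Arguments. Unset Strict Implicit. Unset Printing Implicit Defensive.
Import GRing.Theory.
Local Open Scope ring_scope.

(* Integral domains are represented as subrings A (predicates) of an ambient field F. *)
Section Generic.
Variable F : fieldType.
Implicit Types (A B I J P M : F -> Prop).

Definition subset_of I J := forall x, I x -> J x.

Definition subring A :=
  [/\ A 0, A 1, (forall x y, A x -> A y -> A (x - y)) & (forall x y, A x -> A y -> A (x * y))].

Definition qfrac A (x : F) := exists a b, [/\ A a, A b, b != 0 & x = a / b].

Definition ideal A I :=
  [/\ subset_of I A, I 0, (forall x y, I x -> I y -> I (x + y)) &
      (forall a x, A a -> I x -> I (a * x))].

Definition prime_ideal A P :=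
  [/\ ideal A P, ~ P 1 & (forall x y, A x -> A y -> P (x * y) -> P x \/ P y)].

Definition maximal_ideal A M :=
  [/\ ideal A M, ~ M 1 &
      (forall J, ideal A J -> ~ J 1 -> subset_of M J -> subset_of J M)].

Definition localization A P (x : F) := exists a s, [/\ A a, A s, ~ P s & x = a / s].

Definition colon A I (x : F) := qfrac A x /\ (forall i, I i -> A (x * i)).
Definition vclosure A I := colon A (colon A I).

Definition span A (l : seq F) (x : F) :=
  exists c : nat -> F, (forall i, A (c i)) /\ x = \sum_(i < size l) c i * l`_i.

Definition tclosure A I (x : F) :=
  exists l : seq F, [/\ (forall y, y \in l -> I y), has (fun y => y != 0) l &
                        vclosure A (span A l) x].

Definition t_ideal A I :=
  ideal A I /\ ((forall x, I x -> x = 0) \/ (forall x, I x <-> tclosure A I x)).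

Definition t_prime A P := prime_ideal A P /\ t_ideal A P.

Definition t_maximal A M :=
  [/\ t_ideal A M, ~ M 1 &
      (forall J, t_ideal A J -> ~ J 1 -> subset_of M J -> subset_of J M)].

Definition valuation_domain B :=
  forall x, qfrac B x -> x != 0 -> B x \/ B x^-1.

Definition PvMD A := forall M, t_maximal A M -> valuation_domain (localization A M).

Definition Prufer A := forall M, maximal_ideal A M -> valuation_domain (localization A M).

Definition krull_type A :=
  exists fam : (F -> Prop) -> Prop,
    [/\ (forall P, fam P -> prime_ideal A P /\ valuation_domain (localization A P)),
        (forall x, A x <-> (qfrac A x /\ forall P, fam P -> localization A P x)) &
        (forall x, A x -> x != 0 ->
           exists l : seq (F -> Prop), forall P, fam P -> ~ localization A P x^-1 ->
             exists Q, List.In Q l /\ (forall y, P y <-> Q y))].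
End Generic.

Section IntValued.
Variable K : fieldType.
Implicit Types (D P : K -> Prop).

Definition int_poly D (g : {poly K}) := forall d, D d -> D g.[d].

Definition IntD D : {fraction {poly K}} -> Prop :=
  fun y => exists g, int_poly D g /\ y = FracField.tofrac g.

Definition IntD_loc D P (g : {poly K}) :=
  exists f s, [/\ int_poly D f, D s, ~ P s & g = s^-1 *: f].

Definition poly_over_loc D P (g : {poly K}) := forall i, localization D P g`_i.

Definition Lambda0 D P :=
  t_prime D P /\ ~ (forall g, IntD_loc D P g <-> poly_over_loc D P g).

(* D_0 = ∩_{P ∈ Λ_0} D_P  (= K if Λ_0 is empty) *)
Definition D0 D (x : K) := qfrac D x /\ (forall P, Lambda0 D P -> localization D P x).
End IntValued.

(* Main.v *)
(* Write V = D_P for P in Lambda_0.  Some f in Int(D) has a coefficient outside V.  Since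
   h(X) = f(xX) - x^n f(X) has smaller degree, the values of f at powers of x bound its
   coefficients up to factors x^j and 1 - x^k; hence D/P satisfies x^e = 1 off P, PV is
   principal, P is maximal and belongs to the defining family, and a polynomial mapping D into V
   lies in Int(D)_P.  It follows that every proper ideal of Int(D) containing P lies in a
   t-maximal ideal.

   If Int(D) is a PvMD, applying this to {f | f(0) in P} shows that V has rank one, so that a
   maximal ideal of Int(D_0) meeting D nontrivially contracts to some P in Lambda_0, and its
   contraction to Int(D) lies in a t-maximal ideal, where the localization is a valuation domain.
   Conversely, let M be t-maximal in Int(D) and 0 <> p in M.  For each of the finitely many
   members P of the family containing p, either some z in M forces every phi with phi z in Int(D)
   to map D into D_P, or M lies in the center of the Gauss extension of D_P (P outside Lambda_0), or the
   contraction of M lies in P and Int(D_0) is contained in Int(D)_M (P in Lambda_0).  The first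
   alternative cannot hold for all P, as p and the z's would generate an ideal J with J^v = (1). *)
Require Import Defs.
From HB Require Import structures.
From mathcomp Require Import all_boot all_order all_algebra.
From mathcomp Require Import boolp classical_sets.
From mathcomp Require Import ring zify.
Set Implicit Arguments. Unset Strict Implicit. Unset Printing Implicit Defensive.
Import GRing.Theory.
Local Open Scope ring_scope.
Local Notation "f %:F" := (FracField.tofrac f).

(** * Subrings of a field, localizations, t-ideals *)

Section Subring.
Variables (F : fieldType) (A : F -> Prop).
Hypothesis hA : subring A.

Lemma sub0 : A 0. Proof. by case: hA. Qed.
Lemma sub1 : A 1. Proof. by case: hA. Qed.
Lemma subB x y : A x -> A y -> A (x - y). Proof. by case: hA => _ _ H _; apply: H. Qed.
Lemma subM x y : A x -> A y -> A (x * y). Proof. by case: hA => _ _ _; apply. Qed.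
Lemma subN x : A x -> A (- x).
Proof. by move=> Ax; rewrite -sub0r; apply: subB => //; apply: sub0. Qed.
Lemma subD x y : A x -> A y -> A (x + y).
Proof. by move=> Ax Ay; rewrite -[y]opprK; apply: subB => //; apply: subN. Qed.
Lemma subX n x : A x -> A (x ^+ n).
Proof. by move=> Ax; elim: n => [|n IH]; rewrite ?expr0 ?exprS; [apply: sub1|apply: subM]. Qed.

Lemma sub_sum (I : Type) (r : seq I) (Q : pred I) (G : I -> F) :
  (forall i, Q i -> A (G i)) -> A (\sum_(i <- r | Q i) G i).
Proof. by move=> H; apply: (big_ind A) => //; [apply: sub0|apply: subD]. Qed.

Lemma sub_horner (p : {poly F}) x : (forall i, A p`_i) -> A x -> A p.[x].
Proof.
by move=> Ap Ax; rewrite horner_coef; apply: sub_sum => i _; apply: subM => //; apply: subX.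
Qed.

(** Turns one witness per prime of a finite list into a single witness: the product keeps a
    multiplicative property [Q] and is a multiple of every entry. *)
Lemma sub_seqM (l : seq F) (Q : F -> Prop) :
  Q 1 -> (forall x y, A x -> A y -> Q x -> Q y -> Q (x * y)) ->
  (forall y, y \in l -> A y /\ Q y) ->
  [/\ A (\prod_(y <- l) y), Q (\prod_(y <- l) y) &
      forall y, y \in l -> exists2 c, A c & \prod_(y <- l) y = c * y].
Proof.
move=> Q1 QM; elim: l => [|z l IH] H; first by rewrite big_nil; split=> //; apply: sub1.
case: IH => [y yl|Al Ql Dl]; first by apply: H; rewrite inE yl orbT.
have [Az Qz] : A z /\ Q z by apply: H; rewrite mem_head.
rewrite big_cons; split; [exact: subM|exact: QM|move=> y].
rewrite inE => /orP[/eqP->|/Dl[c Ac ->]]; first by exists (\prod_(j <- l) j); rewrite // mulrC.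
by exists (z * c); [apply: subM|rewrite mulrA].
Qed.

Section Prime.
Variable P : F -> Prop.
Hypothesis hP : prime_ideal A P.

Lemma primeA x : P x -> A x. Proof. by case: hP => -[H _ _ _] _ _; apply: H. Qed.
Lemma prime0 : P 0. Proof. by case: hP => -[_ H _ _] _ _. Qed.
Lemma primeD x y : P x -> P y -> P (x + y). Proof. by case: hP => -[_ _ H _] _ _; apply: H. Qed.
Lemma primeMl a x : A a -> P x -> P (a * x). Proof. by case: hP => -[_ _ _ H] _ _; apply: H. Qed.
Lemma primeMr a x : A a -> P x -> P (x * a). Proof. by rewrite mulrC; apply: primeMl. Qed.
Lemma primeN x : P x -> P (- x).
Proof. by move=> Px; rewrite -mulN1r; apply: primeMl => //; apply/subN/sub1. Qed.
Lemma prime1 : ~ P 1. Proof. by case: hP. Qed.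
Lemma prime_memM x y : A x -> A y -> P (x * y) -> P x \/ P y. Proof. by case: hP => _ _; apply. Qed.
Lemma primeNM x y : A x -> A y -> ~ P x -> ~ P y -> ~ P (x * y).
Proof. by move=> Ax Ay nx ny /(prime_memM Ax Ay)[]. Qed.
Lemma primeX n x : A x -> P (x ^+ n) -> P x.
Proof.
move=> Ax; elim: n => [|n IH]; first by rewrite expr0 => /prime1.
by rewrite exprS => /(prime_memM Ax (subX n Ax))[].
Qed.
Lemma prime_neq0 s : ~ P s -> s != 0.
Proof. by move=> nPs; apply/eqP=> s0; apply: nPs; rewrite s0; apply: prime0. Qed.

Local Notation V := (localization A P).

Lemma loc_sub x : A x -> V x.
Proof. by move=> Ax; exists x, 1; rewrite divr1; split=> //; [apply: sub1|apply: prime1]. Qed.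

Lemma loc_inv s : A s -> ~ P s -> V s^-1.
Proof. by move=> As nPs; exists 1, s; rewrite div1r; split=> //; apply: sub1. Qed.

Lemma loc_subring : subring V.
Proof.
split; [exact/loc_sub/sub0|exact/loc_sub/sub1| |].
  move=> _ _ [a [s [Aa As Ps ->]]] [b [t [Ab At Pt ->]]].
  exists (a * t - b * s), (s * t); split; [|exact: subM|exact: primeNM|].
    by apply: subB; apply: subM.
  by field; rewrite !prime_neq0.
move=> _ _ [a [s [Aa As Ps ->]]] [b [t [Ab At Pt ->]]].
exists (a * b), (s * t); split; [exact: subM|exact: subM|exact: primeNM|].
by field; rewrite !prime_neq0.
Qed.

(** The maximal ideal of the local ring [V], that is, the extension of [P]. *)
Definition locmax (x : F) := exists a s, [/\ P a, A s, ~ P s & x = a / s].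

Lemma locmaxP x : P x -> locmax x.
Proof. by move=> Px; exists x, 1; rewrite divr1; split=> //; [apply: sub1|apply: prime1]. Qed.

Lemma locmaxA x : A x -> locmax x -> P x.
Proof.
move=> Ax [a [s [Pa As nPs E]]].
have: P (x * s) by rewrite E divfK ?prime_neq0.
by case/(prime_memM Ax As).
Qed.

Lemma locmaxD x y : locmax x -> locmax y -> locmax (x + y).
Proof.
move=> [a [s [Pa As Ps ->]]] [b [t [Pb At Pt ->]]].
exists (a * t + b * s), (s * t); split; [|exact: subM|exact: primeNM|].
  by apply: primeD; apply: primeMr.
by field; rewrite !prime_neq0.
Qed.

Lemma locmaxM x y : V x -> locmax y -> locmax (x * y).
Proof.
move=> [a [s [Aa As Ps ->]]] [b [t [Pb At Pt ->]]].
exists (a * b), (s * t); split; [exact: primeMl|exact: subM|exact: primeNM|].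
by field; rewrite !prime_neq0.
Qed.

Lemma locmax_unit x : V x -> ~ locmax x -> x != 0 /\ V x^-1.
Proof.
move=> [a [s [Aa As Ps ->]]] nm.
have nPa : ~ P a by move=> Pa; apply: nm; exists a, s.
split; first by rewrite mulf_neq0 ?invr_eq0 ?prime_neq0.
by rewrite invf_div; exists s, a.
Qed.

Lemma locmax1 : ~ locmax 1.
Proof. by move/(locmaxA sub1)/prime1. Qed.

Lemma locmax_inv x : x != 0 -> locmax x -> ~ V x^-1.
Proof. by move=> x0 mx Vx; apply: locmax1; rewrite -(mulVf x0); apply: locmaxM. Qed.

Lemma loc_common_denom (l : seq F) : (forall y, y \in l -> V y) ->
  exists s, [/\ A s, ~ P s & forall y, y \in l -> A (s * y)].
Proof.
elim: l => [|z l IH] H; first by exists 1; split=> //; [apply: sub1|apply: prime1].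
case: IH => [y yl|s [As Ps Hs]]; first by apply: H; rewrite inE yl orbT.
have [a [t [Aa At Pt E]]] : V z by apply: H; rewrite mem_head.
exists (s * t); split; [exact: subM|exact: primeNM|move=> y].
rewrite inE => /orP[/eqP->|yl].
  have -> : s * t * z = s * a by rewrite E; field; rewrite prime_neq0.
  exact: subM.
by rewrite mulrAC; apply: subM => //; apply: Hs.
Qed.

End Prime.

(** Finitely generated fractional ideals of a valuation ring are principal; [z] is an entry of least
    value. *)
Lemma valuation_divisor (l : seq F) :
  (forall x, x != 0 -> A x \/ A x^-1) -> has (fun y => y != 0) l ->
  exists z, [/\ z \in l, z != 0 & forall y, y \in l -> A (y / z)].
Proof.
move=> hv; elim: l => //= y l IH.
have [hl _|hl] := boolP (has (fun y => y != 0) l); last first.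
  rewrite orbF => y0; exists y; split=> //; first by rewrite mem_head.
  move=> z; rewrite inE => /orP[/eqP->|zl]; first by rewrite divff //; apply: sub1.
  move/hasPn: hl => /(_ z zl); rewrite negbK => /eqP->; rewrite mul0r; exact: sub0.
have [z [zl z0 Hz]] := IH hl.
have [->|y0] := eqVneq y 0.
  exists z; split=> //; first by rewrite inE zl orbT.
  by move=> w; rewrite inE => /orP[/eqP->|/Hz//]; rewrite mul0r; apply: sub0.
have yz0 : y / z != 0 by rewrite mulf_neq0 ?invr_eq0.
case: (hv _ yz0) => Ayz.
  exists z; split=> //; first by rewrite inE zl orbT.
  by move=> w; rewrite inE => /orP[/eqP->|/Hz].
exists y; split=> //; first by rewrite mem_head.
move=> w; rewrite inE => /orP[/eqP->|/Hz Aw]; first by rewrite divff //; apply: sub1.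
have -> : w / y = (w / z) * (y / z)^-1 by field; rewrite y0 z0.
exact: subM.
Qed.

End Subring.

(** The condition [C] speaks only of finite lists, and a finite list in the union of a chain already
    lies in one member, so Zorn's lemma applies. It serves both maximal and t-maximal ideals. *)
Lemma ideal_zorn (F : fieldType) (A I : F -> Prop) (C : seq F -> Prop) :
  ideal A I -> (forall l, (forall y, y \in l -> I y) -> C l) ->
  exists M, [/\ ideal A M, subset_of I M, forall l, (forall y, y \in l -> M y) -> C l &
    forall J, ideal A J -> (forall l, (forall y, y \in l -> J y) -> C l) ->
      subset_of M J -> subset_of J M].
Proof.
move=> idI CI.
pose good X := [/\ ideal A X, subset_of I X & forall l, (forall y, y \in l -> X y) -> C l].
pose T (X : F -> Prop) := (forall x, ~ X x) \/ good X.
have [|M [TM maxM]] := @Zorn_bigcup F T.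
  move=> S ST tot; have [[X SX [x Xx]]|nS] := pselect (exists2 X, S X & exists x, X x); last first.
    by left=> x [X SX Xx]; apply: nS; exists X => //; exists x.
  have gd Y y : S Y -> Y y -> good Y by move=> /ST[/(_ y)|].
  have [[XA X0 XD XM] IX CX] := gd _ _ SX Xx.
  have ub (l : seq F) : (forall y, y \in l -> exists2 Y, S Y & Y y) ->
      exists Y, [/\ S Y, good Y & forall y, y \in l -> Y y].
    elim: l => [|z l IH] H; first by exists X; split=> //; apply: gd Xx.
    case: IH => [y yl|Y [SY gY lY]]; first by apply: H; rewrite inE yl orbT.
    have [Z SZ Zz] : exists2 Y, S Y & Y z by apply: H; rewrite mem_head.
    have [YZ|ZY] := tot _ _ SY SZ.
      exists Z; split=> //; first exact: gd Zz.
      by move=> y; rewrite inE => /orP[/eqP->//|/lY/YZ].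
    exists Y; split=> //.
    by move=> y; rewrite inE => /orP[/eqP->//|/lY//]; apply: ZY.
  right; split.
  - split.
    + by move=> y [Y SY Yy]; have [[YA _ _ _] _ _] := gd _ _ SY Yy; apply: YA.
    + by exists X.
    + move=> y z Hy Hz; have [|Y [SY [[_ _ YD _] _ _] HY]] := ub [:: y; z].
        by move=> w; rewrite !inE => /orP[]/eqP->.
      by exists Y => //; apply: YD; apply: HY; rewrite !inE eqxx ?orbT.
    + move=> a y Aa [Y SY Yy]; exists Y => //.
      by have [[_ _ _ YM] _ _] := gd _ _ SY Yy; apply: YM.
  - by move=> y /IX Xy; exists X.
  - by move=> l /ub[Y [_ [_ _ CY]]] /CY.
have [IA I0 ID IM] := idI.
have TI : T I by right; split.
have gM : good M.
  case: TM => // M0; exfalso; apply: (maxM I) => //; split; last by move/(_ _ I0)/M0.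
  by move=> x /M0.
have [idM IsM CM] := gM; exists M; split=> // J idJ CJ MJ x Jx.
have [//|nMx] := pselect (M x); exfalso; apply: (maxM J); first by split=> // /(_ x Jx).
by right; split=> // y /IsM/MJ.
Qed.

(** * The v- and t-operations, and t-maximal ideals *)

Section TIdeals.
Variables (F : fieldType) (A : F -> Prop).
Hypotheses (hA : subring A) (hq : forall x, qfrac A x).

Lemma span_mem (l : seq F) y : y \in l -> Defs.span A l y.
Proof.
move=> yl; exists (fun i => (i == index y l)%:R); split.
  by move=> i; case: (_ == _); [apply: sub1|apply: sub0].
have il : (index y l < size l)%N by rewrite index_mem.
rewrite (bigD1 (Ordinal il)) //= eqxx mul1r nth_index // big1 ?addr0 // => i ne.
have -> : (i == index y l :> nat) = false by apply/negbTE; apply: contra ne => /eqP e; apply/eqP/val_inj.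
by rewrite mul0r.
Qed.

Lemma vclosure_spanE l x : vclosure A (Defs.span A l) x <->
  (forall phi, (forall y, y \in l -> A (phi * y)) -> A (x * phi)).
Proof.
split=> [[_ H] phi Hphi|H].
  apply: H; split=> // _ [c [Ac ->]]; rewrite mulr_sumr; apply: sub_sum => // i _.
  by rewrite mulrCA; apply: subM => //; apply: Hphi; rewrite mem_nth.
split=> // phi [_ Hphi]; apply: H => y yl; apply: Hphi; exact: span_mem.
Qed.

Definition tproper I := forall l : seq F, (forall y, y \in l -> I y) ->
  has (fun y => y != 0) l -> ~ vclosure A (Defs.span A l) 1.

Lemma tclosure_ideal I : ideal A I -> (exists2 x, I x & x != 0) -> ideal A (tclosure A I).
Proof.
move=> idI [x0 Ix0 x00]; split.
- move=> x [l [lI _ /vclosure_spanE Hl]].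
  rewrite -[x]mulr1; apply: Hl => y yl; rewrite mul1r.
  by case: idI => IA _ _ _; apply/IA/lI.
- exists [:: x0]; split; [by move=> y; rewrite inE => /eqP->|by rewrite /= x00|].
  by apply/vclosure_spanE => phi _; rewrite mul0r; apply: sub0.
- move=> x y [l [lI l0 /vclosure_spanE Hl]] [k [kI k0 /vclosure_spanE Hk]].
  exists (l ++ k); split; [|by rewrite has_cat l0|].
    by move=> z; rewrite mem_cat => /orP[/lI|/kI].
  apply/vclosure_spanE => phi Hphi; rewrite mulrDl; apply: subD => //.
    by apply: Hl => z zl; apply: Hphi; rewrite mem_cat zl.
  by apply: Hk => z zl; apply: Hphi; rewrite mem_cat zl orbT.
- move=> a x Aa [l [lI l0 /vclosure_spanE Hl]]; exists l; split=> //.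
  by apply/vclosure_spanE => phi /Hl ?; rewrite -mulrA; apply: subM.
Qed.

Lemma tclosure_sub I : (exists2 x, I x & x != 0) -> subset_of I (tclosure A I).
Proof.
move=> [x0 Ix0 x00] x Ix; exists [:: x; x0]; split.
- by move=> y; rewrite !inE => /orP[]/eqP->.
- by rewrite /= x00 orbT.
- by apply/vclosure_spanE => phi H; rewrite mulrC; apply: H; rewrite mem_head.
Qed.

(** Idempotence of the t-operation. Each entry of [l] lies in the v-closure of a finite list from
    [I]; whatever multiplies the concatenation [k] of these lists into [A] also multiplies [l] into
    [A]. *)
Lemma tclosure_idem I l : (forall y, y \in l -> tclosure A I y) -> has (fun y => y != 0) l ->
  exists k, [/\ forall y, y \in k -> I y, has (fun y => y != 0) k &
    forall x, vclosure A (Defs.span A l) x -> vclosure A (Defs.span A k) x].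
Proof.
move=> H l0.
suff [k [kI k0 Hk]] : exists k, [/\ forall y, y \in k -> I y,
    (l != [::] -> has (fun y => y != 0) k) &
    forall phi, (forall y, y \in k -> A (phi * y)) -> forall y, y \in l -> A (phi * y)].
  exists k; split=> //; first by apply: k0; case: l l0 {H Hk}.
  by move=> x /vclosure_spanE Hx; apply/vclosure_spanE => phi /Hk; apply: Hx.
elim: l H {l0} => [|z l IH] H; first by exists [::].
case: IH => [y yl|k [kI _ Hk]]; first by apply: H; rewrite inE yl orbT.
have [k' [k'I k'0 /vclosure_spanE Hk']] : tclosure A I z by apply: H; rewrite mem_head.
exists (k' ++ k); split; [|by rewrite has_cat k'0|].
  by move=> y; rewrite mem_cat => /orP[/k'I|/kI].
move=> phi Hphi y; rewrite inE => /orP[/eqP->|yl].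
  by rewrite mulrC; apply: Hk' => w wk; apply: Hphi; rewrite mem_cat wk.
by apply: Hk yl => w wk; apply: Hphi; rewrite mem_cat wk orbT.
Qed.

(** An ideal maximal among the [tproper] ones equals its t-closure when nonzero, since by
    idempotence the t-closure is again [tproper]. *)
Lemma tproper_sub_tmaximal I : ideal A I -> tproper I ->
  exists2 M, t_maximal A M & subset_of I M.
Proof.
move=> idI tI.
pose C l := has (fun y : F => y != 0) l -> ~ vclosure A (Defs.span A l) 1.
have [l lI|M [idM IM CM maxM]] := ideal_zorn (C := C) idI; first exact: tI.
have nz_of (J : F -> Prop) : ~ (forall x, J x -> x = 0) -> exists2 x, J x & x != 0.
  by move/existsPNP => [x Jx /eqP ?]; exists x.
exists M => //; split.
- split=> //; have [M0|/nz_of nzM] := pselect (forall x, M x -> x = 0); [by left|right=> x].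
  split; first exact: tclosure_sub.
  apply: maxM; [exact: tclosure_ideal| |exact: tclosure_sub].
  move=> l lM l0; have [k [kM k0 Hk]] := tclosure_idem lM l0.
  by move=> /Hk; apply: CM.
- move=> M1; apply: (CM [:: 1]); first by move=> y; rewrite inE => /eqP->.
    by rewrite /= oner_neq0.
  by apply/vclosure_spanE => phi /(_ 1); rewrite mulr1 mul1r mem_head; apply.
- move=> J [idJ tJ] J1 MJ; apply: maxM => // l lJ l0 v1.
  case: tJ => [J0|tJ]; last by apply: J1; apply/tJ; exists l.
  by move/hasP: l0 => [y /lJ/J0-> /eqP].
Qed.

Lemma tmaximal_tclosed M l : t_maximal A M -> (forall y, y \in l -> M y) ->
  has (fun y => y != 0) l -> ~ vclosure A (Defs.span A l) 1.
Proof.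
case=> [[idM tM] M1 _] lM l0 v1.
case: tM => [M0|tM]; last by apply: M1; apply/tM; exists l.
by move/hasP: l0 => [y /lM/M0-> /eqP].
Qed.

(** In the valuation ring at [P] a finite list [l] from [P] generates a principal ideal, with
    generator [z] in [l]. For a common denominator [s] outside [P] of the [y / z], the element
    [s / z] multiplies [l] into [A]; hence any [x] in the v-closure has [x * s] in [z A], inside
    [P]. *)
Lemma valuation_t_prime P : prime_ideal A P ->
  (forall x, x != 0 -> localization A P x \/ localization A P x^-1) -> t_prime A P.
Proof.
move=> hP hv; split=> //; split; first by case: hP.
have [P0|nP0] := pselect (forall x, P x -> x = 0); [by left|right=> x].
have nzP : exists2 x, P x & x != 0 by move/existsPNP: nP0 => [z Pz /eqP ?]; exists z.
split; first exact: tclosure_sub.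
case=> l [lP l0 /vclosure_spanE Hl].
have [z [zl z0 Hz]] := valuation_divisor (loc_subring hA hP) hv l0.
have [|s [As nPs Hs]] := @loc_common_denom _ _ hA _ hP [seq y / z | y <- l].
  by move=> _ /mapP[y yl ->]; apply: Hz.
have Axs : A (x * (s / z)).
  apply: Hl => y yl; have -> : s / z * y = s * (y / z) by field.
  by apply/Hs/map_f.
have Ax : A x.
  rewrite -[x]mulr1; apply: Hl => y yl; rewrite mul1r; exact: (primeA hP (lP _ yl)).
have: P (x * s).
  have -> : x * s = x * (s / z) * z by field.
  by apply: (primeMl hP) => //; apply: lP.
by case/(prime_memM hP Ax As).
Qed.

Lemma ideal_sub_maximal I : ideal A I -> ~ I 1 -> exists2 M, maximal_ideal A M & subset_of I M.
Proof.
move=> idI I1; pose C (l : seq F) := 1 \notin l.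
have [l lI|M [idM IM CM maxM]] := ideal_zorn (C := C) idI.
  by apply/negP => /lI.
exists M => //; split=> //.
  move=> M1; have := CM [:: 1]; rewrite /C mem_head => H.
  by apply: notF; apply: H => y; rewrite inE => /eqP->.
by move=> J idJ J1; apply: maxM => // l lJ; apply/negP => /lJ.
Qed.

End TIdeals.

Section Ideals.
Variables (F : fieldType) (A : F -> Prop).
Hypothesis hA : subring A.

Lemma idealN I x : ideal A I -> I x -> I (- x).
Proof. by case=> _ _ _ IM Ix; rewrite -mulN1r; apply: IM => //; apply/(subN hA)/(sub1 hA). Qed.

Lemma idealB I x y : ideal A I -> I x -> I y -> I (x - y).
Proof. by move=> idI Ix Iy; have [_ _ ID _] := idI; apply: ID => //; apply: idealN. Qed.

Lemma ideal_expr_sub1 I x n : ideal A I -> A x -> I (x - 1) -> I (x ^+ n - 1).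
Proof.
move=> [_ I0 ID IM] Ax Ix; elim: n => [|n IH]; first by rewrite expr0 subrr.
have -> : x ^+ n.+1 - 1 = x * (x ^+ n - 1) + (x - 1) by rewrite exprS; ring.
by apply: ID => //; apply: IM.
Qed.

Lemma maximal_prime M : maximal_ideal A M -> prime_ideal A M.
Proof.
move=> [idM M1 maxM]; split=> // x y Ax Ay Mxy.
have [MA M0 MD MM] := idM.
have [Mx|nMx] := pselect (M x); [by left|right].
pose J z := exists m a, [/\ M m, A a & z = m + a * x].
have idJ : ideal A J.
  split.
  - by move=> _ [m [a [/MA Am Aa ->]]]; apply: subD => //; apply: subM.
  - by exists 0, 0; split=> //; [apply: sub0|rewrite mul0r addr0].
  - move=> _ _ [m [a [Mm Aa ->]]] [k [b [Mk Ab ->]]].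
    by exists (m + k), (a + b); split; [apply: MD|apply: subD|ring].
  - move=> c _ Ac [m [a [Mm Aa ->]]].
    by exists (c * m), (c * a); split; [apply: MM|apply: subM|ring].
have MJ : subset_of M J.
  by move=> m Mm; exists m, 0; split=> //; [apply: sub0|rewrite mul0r addr0].
have [[m [a [Mm Aa E]]]|nJ1] := pselect (J 1).
  have -> : y = y * m + a * (x * y) by rewrite -[LHS]mulr1 E; ring.
  by apply: MD; apply: MM.
case: nMx; apply: (maxM J) => //.
by exists 0, 1; split=> //; [apply: sub1|rewrite mul1r add0r].
Qed.

Lemma localization_subset P Q x : subset_of P Q -> localization A Q x -> localization A P x.
Proof. by move=> PQ [a [s [Aa As nQs ->]]]; exists a, s; split=> // /PQ. Qed.

Lemma localization_qfrac P x : ~ P 1 -> qfrac A x -> qfrac (localization A P) x.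
Proof.
have A1 := sub1 hA; move=> P1 [a [b [Aa Ab b0 ->]]]; exists a, b; split=> //.
  by exists a, 1; rewrite divr1.
by exists b, 1; rewrite divr1.
Qed.

End Ideals.

(** * Integer-valued polynomials *)

Section Dilation.
Variable K : fieldType.
Implicit Types (f g : {poly K}) (B : K -> Prop).

(** For f of degree at most n this is f(xX) - x^n f(X): the terms of degree n cancel. *)
Definition dilation n (x : K) f := \poly_(i < n) (f`_i * (x ^+ i - x ^+ n)).

Lemma horner_dilation n x f y : (size f <= n.+1)%N ->
  (dilation n x f).[y] = f.[x * y] - x ^+ n * f.[y].
Proof.
move=> sf; rewrite horner_poly !(horner_coef_wide _ sf) mulr_sumr -sumrB big_ord_recr /=.
rewrite [X in _ + X](_ : _ = 0) ?addr0; last by rewrite exprMn; ring.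
by apply: eq_bigr => i _; rewrite exprMn; ring.
Qed.

(** Induction on n. The values of the dilation at powers of x lie in B, so its coefficients are
    bounded by induction. Its k-th coefficient is f_k x^k (1 - x^(n+1-k)); removing the unit and the
    factor x^k costs at most x^n, which the gap 2n + 1 between consecutive squares absorbs. *)
Lemma coef_of_values_at_powers B x n f : subring B -> B x ->
  (forall k, (0 < k <= n)%N -> 1 - x ^+ k != 0 /\ B (1 - x ^+ k)^-1) ->
  (size f <= n.+1)%N -> (forall i, B f.[x ^+ i]) -> forall i, B (x ^+ (n ^ 2) * f`_i).
Proof.
move=> hB Bx; elim: n f => [|n IH] f hx sf vf i.
  have := vf 0; rewrite (size1_polyC sf) hornerC expr0 mul1r coefC.
  by case: eqP => // _ _; apply: sub0.
have Hh : forall j, B (x ^+ (n ^ 2) * (dilation n.+1 x f)`_j).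
  apply: IH; [|exact: size_poly|].
    by move=> k /andP[k0 kn]; apply: hx; rewrite k0 ltnW.
  move=> j; rewrite horner_dilation // -exprS; apply: subB => //.
  by apply: subM => //; apply: subX.
have lowk k : (k <= n)%N -> B (x ^+ (n.+1 ^ 2) * f`_k).
  move=> kn; have [] := hx (n.+1 - k)%N; first by lia.
  set u := 1 - _ => u0 Bu.
  have -> : x ^+ (n.+1 ^ 2) * f`_k =
      x ^+ (n.+1 ^ 2 - n ^ 2 - k) * u^-1 * (x ^+ (n ^ 2) * (dilation n.+1 x f)`_k).
    rewrite coef_poly ltnS kn.
    have -> : x ^+ k - x ^+ n.+1 = x ^+ k * u.
      by rewrite /u mulrBr mulr1 -exprD subnKC // ltnW.
    have -> : (n.+1 ^ 2 = (n.+1 ^ 2 - n ^ 2 - k) + n ^ 2 + k)%N by nia.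
    rewrite !exprD; set N := (_ - k)%N.
    have -> : (N + n ^ 2 + k - n ^ 2 - k = N)%N by lia.
    by field.
  by apply: subM => //; apply: subM => //; apply: subX.
have [/lowk//|ni] := leqP i n.
have [->|ni1] := eqVneq i n.+1; last first.
  by rewrite nth_default ?mulr0; [apply: sub0|apply: leq_trans sf _; lia].
(* The top coefficient is invisible in the dilation; it is recovered from the value at 1. *)
have -> : f`_n.+1 = f.[x ^+ 0] - \sum_(k < n.+1) f`_k.
  rewrite expr0 (horner_coef_wide _ sf) big_ord_recr /= expr1n mulr1.
  rewrite (eq_bigr (fun i : 'I_n.+1 => f`_i)) => [|k _]; last by rewrite expr1n mulr1.
  by rewrite addrAC subrr add0r.
rewrite mulrBr mulr_sumr; apply: subB => //.
  by apply: subM => //; apply: subX.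
by apply: sub_sum => // k _; apply: lowk; rewrite -ltnS.
Qed.

(** Induction on the degree. At a/s the dilation by s takes the value f(a) - s^(n+1) f(a/s), which
    lies in the localization by induction, and s is a unit there. *)
Lemma int_poly_localization (D P : K -> Prop) f x : subring D -> prime_ideal D P ->
  (forall y, D y -> localization D P f.[y]) -> localization D P x -> localization D P f.[x].
Proof.
move=> hD hP; have hV := loc_subring hD hP.
have: (size f <= (size f).+1)%N by [].
move: {2}(size f) => n; elim: n f x => [|n IH] f x sf Vf [a [s [Da Ds nPs ->]]].
  by have := Vf _ (sub0 hD); rewrite (size1_polyC sf) !hornerC.
have s0 := prime_neq0 hP nPs.
have : localization D P (dilation n.+1 s f).[a / s].
  apply: IH; [exact: size_poly| |by exists a, s].
  move=> y Dy; rewrite horner_dilation //; apply: subB => //; first exact/Vf/(subM hD).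
  by apply: subM; [|exact/(loc_sub hD hP)/(subX hD)|apply: Vf].
rewrite horner_dilation // mulrC divfK // => H.
have -> : f.[a / s] = s^-1 ^+ n.+1 * (f.[a] - (f.[a] - s ^+ n.+1 * f.[a / s])).
  by rewrite opprB addrCA subrr addr0 exprVn mulKf // expf_neq0.
apply: subM => //; first by apply: (subX hV); exact: (loc_inv hD Ds nPs).
by apply: subB => //; apply: Vf.
Qed.

(** * Gauss's lemma over a localization *)

Section Gauss.
Variables (A P : K -> Prop).
Hypotheses (hA : subring A) (hP : prime_ideal A P).
Local Notation V := (localization A P).
Local Notation m := (locmax A P).
Let hV := loc_subring hA hP.

(** If i and j are the least indices of unit coefficients of f and g, then the coefficient of index
    i + j in the product is f_i g_j modulo [m]. *)
Lemma gauss_coef f g : (forall i, V f`_i) -> (forall i, V g`_i) ->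
  (exists i, ~ m f`_i) -> (exists i, ~ m g`_i) -> exists i, ~ m (f * g)`_i.
Proof.
have minc h : (exists i, ~ m h`_i) -> exists i, ~ m h`_i /\ forall j, (j < i)%N -> m h`_j.
  move=> [i0 hi0]; have ex : exists i, `[< ~ m h`_i >] by exists i0; apply/asboolP.
  case: (ex_minnP ex) => i /asboolP hi mi; exists i; split=> // j ji.
  apply: contrapT => /asboolP/mi; lia.
move=> Vf Vg /minc[i [hi mi]] /minc[j [hj mj]]; exists (i + j)%N.
have ij : (i < (i + j).+1)%N by lia.
rewrite coefM (bigD1 (Ordinal ij)) //= addKn => H.
have mN x : m x -> m (- x).
  by move=> mx; rewrite -mulN1r; apply: (locmaxM hA hP) mx; apply/(subN hV)/(sub1 hV).
have H2 : m (\sum_(k < (i + j).+1 | k != Ordinal ij) f`_k * g`_(i + j - k)).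
  apply: (big_ind m) => [||k ki]; first exact: (locmaxP hA hP (prime0 hP)).
    by move=> x y; apply: locmaxD.
  have [lki|] := ltnP k i; first by rewrite mulrC; apply: locmaxM => //; apply: mi.
  rewrite leq_eqVlt => /orP[/eqP e|lik].
    by case/eqP: ki; apply/val_inj.
  by apply: locmaxM => //; apply: mj; have := ltn_ord k; lia.
have : m (f`_i * g`_j).
  rewrite -[f`_i * g`_j](addrK (\sum_(k < (i + j).+1 | k != Ordinal ij) f`_k * g`_(i + j - k))).
  by apply: locmaxD => //; apply: mN.
have [fi0 Vfi] := locmax_unit hP (Vf i) hi.
by move=> /(locmaxM hA hP Vfi); rewrite mulKf.
Qed.

Hypothesis hv : forall x, x != 0 -> V x \/ V x^-1.

(** Otherwise a coefficient [z] of [phi] of least value lies outside [V]. Then [z^-1 *: phi] has a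
    unit coefficient, while its product with [f] has all coefficients in [m], against Gauss's
    lemma. *)
Lemma gauss_div f phi : (forall i, V f`_i) -> (exists i, ~ m f`_i) ->
  (forall i, V (phi * f)`_i) -> forall i, V phi`_i.
Proof.
move=> Vf cf Vpf i; apply: contrapT => nV.
have V0 := sub0 hV.
have hi : (i < size phi)%N by rewrite ltnNge; apply/negP => h; apply: nV; rewrite nth_default.
have nz : has (fun y => y != 0) phi.
  apply/hasP; exists phi`_i; first exact: mem_nth.
  by apply/eqP => e; apply: nV; rewrite e.
have [z [zl z0 Hz]] := valuation_divisor hV hv nz.
have nVz : ~ V z.
  move=> Vz; apply: nV; rewrite -(divfK z0 phi`_i); apply: subM => //; apply: Hz; exact: mem_nth.
have mz : m z^-1.
  case: (hv z0) => // Vz; apply: contrapT => /(locmax_unit hP Vz)[_].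
  by rewrite invrK.
have [| |k hk] := @gauss_coef (z^-1 *: phi) f _ Vf _ cf.
- move=> k; rewrite coefZ mulrC; have [kl|kl] := ltnP k (size phi); last first.
    by rewrite nth_default // mul0r.
  by apply: Hz; apply: mem_nth.
- exists (index z phi); rewrite coefZ nth_index // mulVf //; exact: locmax1.
- by apply: hk; rewrite -scalerAl coefZ mulrC; apply: locmaxM.
Qed.

End Gauss.
End Dilation.

(** * The ring Int(D) inside K(X) *)

Section IntRing.
Variables (K : fieldType) (D : K -> Prop).
Hypotheses (hD : subring D) (hK : forall x, qfrac D x).
Implicit Types f g : {poly K}.


Lemma poly_denom f : exists d, [/\ D d, d != 0 & forall i, D (d * f`_i)].
Proof.
suff [d [Dd d0 Hd]] : exists d, [/\ D d, d != 0 & forall y, y \in (f : seq K) -> D (d * y)].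
  exists d; split=> // i; have [il|il] := ltnP i (size f); first exact/Hd/mem_nth.
  by rewrite nth_default // mulr0; apply: sub0.
elim: (f : seq K) => [|z l [d [Dd d0 Hd]]].
  by exists 1; split=> //; [apply: sub1|apply: oner_neq0].
have [a [b [Da Db b0 ->]]] := hK z.
exists (d * b); split; [exact: subM|by rewrite mulf_neq0|move=> y].
rewrite inE => /orP[/eqP->|/Hd Hy].
  by have -> : d * b * (a / b) = d * a; [field|apply: subM].
by rewrite mulrAC; apply: subM.
Qed.

Lemma int_poly_over f : (forall i, D f`_i) -> int_poly D f.
Proof. by move=> Df d Dd; apply: sub_horner. Qed.

Lemma int_polyC c : D c -> int_poly D c%:P.
Proof. by move=> Dc d _; rewrite hornerC. Qed.

Lemma int_polyM f g : int_poly D f -> int_poly D g -> int_poly D (f * g).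
Proof. by move=> If Ig d Dd; rewrite hornerM; apply: subM; [|apply: If|apply: Ig]. Qed.

Lemma int_polyB f g : int_poly D f -> int_poly D g -> int_poly D (f - g).
Proof. by move=> If Ig d Dd; rewrite hornerD hornerN; apply: subB; [|apply: If|apply: Ig]. Qed.

Lemma int_polyZ c f : D c -> int_poly D f -> int_poly D (c *: f).
Proof. by move=> Dc If; rewrite -mul_polyC; apply: int_polyM => //; apply: int_polyC. Qed.

Lemma int_poly_prod (fs : seq {poly K}) (h : {poly K} -> {poly K}) :
  (forall f, f \in fs -> int_poly D (h f)) -> int_poly D (\prod_(f <- fs) h f).
Proof.
move=> H; rewrite big_seq; apply: big_ind => //; last exact: int_polyM.
by move=> d _; rewrite hornerC; apply: sub1.
Qed.

Lemma IntD_tofrac f : IntD D f%:F <-> int_poly D f.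
Proof.
split=> [[g [Ig /eqP]]|]; last by exists f.
by rewrite tofrac_eq => /eqP->.
Qed.

Lemma IntD_subring : subring (IntD D).
Proof.
split.
- by rewrite -tofrac0; apply/IntD_tofrac => d _; rewrite horner0; apply: sub0.
- by rewrite -tofrac1; apply/IntD_tofrac => d _; rewrite hornerC; apply: sub1.
- by move=> _ _ [f [If ->]] [g [Ig ->]]; rewrite -tofracB; apply/IntD_tofrac/int_polyB.
- by move=> _ _ [f [If ->]] [g [Ig ->]]; rewrite -tofracM; apply/IntD_tofrac/int_polyM.
Qed.

Lemma tofrac_div_cancel c f g : c != 0 -> (c * f)%:F / (c * g)%:F = f%:F / g%:F.
Proof.
have cancel (F : fieldType) (x y z : F) : z != 0 -> (z * x) / (z * y) = x / y.
  by move=> z0; rewrite -mulf_div divff // mul1r.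
by move=> c0; rewrite !tofracM cancel // tofrac_eq0.
Qed.

Lemma frac_coprime (y : {fraction {poly K}}) :
  exists f g, [/\ g != 0, coprimep f g & y = f%:F / g%:F].
Proof.
have [a [b [b0 ->]]] : exists a b, b != 0 /\ y = a%:F / b%:F.
  elim/quotW: y => x; exists (frac x).1, (frac x).2; split; first exact: denom_ratioP.
  rewrite -[_ / _]/(FracField.mul _ (FracField.inv _)) !piE /FracField.mulf /FracField.invf.
  by rewrite !numden_Ratio ?oner_eq0 ?denom_ratioP // mulr1 mul1r Ratio_numden.
have g0 : gcdp a b != 0 by rewrite gcdp_eq0 negb_and b0 orbT.
exists (a %/ gcdp a b), (b %/ gcdp a b); split.
- by rewrite dvdp_div_eq0 ?dvdp_gcdr.
- by apply: coprimep_div_gcd; rewrite b0 orbT.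
- have Ea := divpK (dvdp_gcdl a b); have Eb := divpK (dvdp_gcdr a b).
  rewrite -[X in X%:F / _ = _]Ea -[X in _ / X%:F = _]Eb.
  by rewrite ![_ * gcdp a b]mulrC tofrac_div_cancel.
Qed.

Lemma IntD_qfrac y : qfrac (IntD D) y.
Proof.
have [f [g [g0 _ ->]]] := frac_coprime y.
have [d [Dd d0 Hd]] := poly_denom f; have [e [De e0 He]] := poly_denom g.
exists ((d * e) *: f)%:F, ((d * e) *: g)%:F; split.
- by apply/IntD_tofrac/int_poly_over => i; rewrite coefZ mulrAC; apply: subM.
- by apply/IntD_tofrac/int_poly_over => i; rewrite coefZ -mulrA; apply: subM.
- by rewrite tofrac_eq0 scaler_eq0 !mulf_eq0 !negb_or d0 e0.
- by rewrite -!mul_polyC tofrac_div_cancel // polyC_eq0 mulf_neq0.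
Qed.

(** Write y = f/g with f and g coprime. If multiples of f and g by the same nonzero constant both
    lay in M, a Bezout relation with cleared denominators would put a nonzero constant into M; so
    one of them can serve as denominator. *)
Lemma valuation_trivial_contraction (M : {fraction {poly K}} -> Prop) :
  ideal (IntD D) M -> (forall d, D d -> M d%:P%:F -> d = 0) ->
  forall y, y != 0 -> localization (IntD D) M y \/ localization (IntD D) M y^-1.
Proof.
move=> [MA M0 MD MM] tr y y0.
have [f [g [g0 /Bezout_coprimepP[[u v] /= uv] Ey]]] := frac_coprime y.
have f0 : f != 0 by apply: contra_neq y0 => f0; rewrite Ey f0 tofrac0 mul0r.
have [d1 [Dd1 d10 Hd1]] := poly_denom f; have [d2 [Dd2 d20 Hd2]] := poly_denom g.
have [e1 [De1 e10 He1]] := poly_denom u; have [e2 [De2 e20 He2]] := poly_denom v.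
pose d := d1 * d2; pose e := e1 * e2.
have d0 : d != 0 by rewrite mulf_neq0.
have If : IntD D (d *: f)%:F.
  by apply/IntD_tofrac/int_poly_over => i; rewrite coefZ mulrAC; apply: subM.
have Ig : IntD D (d *: g)%:F.
  by apply/IntD_tofrac/int_poly_over => i; rewrite coefZ -mulrA; apply: subM.
have Iu : IntD D (e *: u)%:F.
  by apply/IntD_tofrac/int_poly_over => i; rewrite coefZ mulrAC; apply: subM.
have Iv : IntD D (e *: v)%:F.
  by apply/IntD_tofrac/int_poly_over => i; rewrite coefZ -mulrA; apply: subM.
have [Mf|nMf] := pselect (M (d *: f)%:F); last first.
  right; exists (d *: g)%:F, (d *: f)%:F; split=> //.
  by rewrite Ey invf_div -!mul_polyC tofrac_div_cancel // polyC_eq0.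
have [Mg|nMg] := pselect (M (d *: g)%:F); last first.
  left; exists (d *: f)%:F, (d *: g)%:F; split=> //.
  by rewrite Ey -!mul_polyC tofrac_div_cancel // polyC_eq0.
exfalso; move: uv; rewrite eqp_sym => /eqpP[[c1 c2] /= /andP[c10 c20] Ec].
have Euv : u * f + v * g = (c1 / c2)%:P.
  apply: (scalerI c20); by rewrite -Ec -alg_polyC scalerA mulrC divfK.
have Muv := MD _ _ (MM _ _ Iu Mf) (MM _ _ Iv Mg).
have E : (e *: u)%:F * (d *: f)%:F + (e *: v)%:F * (d *: g)%:F = (e * d * (c1 / c2))%:P%:F.
  rewrite -!tofracM -tofracD; congr _%:F.
  by rewrite -!scalerAl -!scalerAr -!scalerDr Euv !scalerA -mul_polyC -polyCM mulrA.
rewrite E in Muv; have /IntD_tofrac/(_ _ (sub0 hD)) := MA _ Muv; rewrite hornerC => Dc.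
have /eqP := tr _ Dc Muv; rewrite !mulf_eq0 invr_eq0.
by rewrite (negbTE c10) (negbTE c20) (negbTE e10) (negbTE e20) (negbTE d10) (negbTE d20).
Qed.

End IntRing.

Lemma ideal_constants (K : fieldType) (E : K -> Prop) (M : {fraction {poly K}} -> Prop) :
  subring E -> ideal (IntD E) M -> ideal E (fun c => M c%:P%:F).
Proof.
move=> hE [MA M0 MD MM]; split.
- move=> c /MA/IntD_tofrac/(_ 0 (sub0 hE)); by rewrite hornerC.
- by rewrite polyC0 tofrac0.
- by move=> x y Mx My; rewrite polyCD tofracD; apply: MD.
- move=> a x Ea Mx; rewrite polyCM tofracM; apply: MM => //.
  by apply/IntD_tofrac; apply: int_polyC.
Qed.

(** * Krull-type domains *)

Section Krull.
Variables (K : fieldType) (D : K -> Prop) (fam : (K -> Prop) -> Prop).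
Hypotheses (hD : subring D) (hK : forall x, qfrac D x).
Hypothesis famP : forall P, fam P -> prime_ideal D P /\ valuation_domain (localization D P).
Hypothesis famI : forall x, D x <-> (qfrac D x /\ forall P, fam P -> localization D P x).
Hypothesis famF : forall x, D x -> x != 0 -> exists l : seq (K -> Prop), forall P, fam P ->
  ~ localization D P x^-1 -> exists Q, List.In Q l /\ (forall y, P y <-> Q y).

Lemma fam_prime P : fam P -> prime_ideal D P. Proof. by case/famP. Qed.

Lemma fam_valuation P x : fam P -> x != 0 -> localization D P x \/ localization D P x^-1.
Proof. by move=> /famP[[_ P1 _] hv]; apply/hv/(localization_qfrac hD). Qed.

Lemma fam_inter x : (forall P, fam P -> localization D P x) -> D x.
Proof. by move=> H; apply/famI. Qed.

(** The form in which local finiteness is used: only finitely many members of the family contain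
    [p], so witnesses chosen for each of them form a finite list [L]. *)
Lemma fam_choice (T : eqType) (R : (K -> Prop) -> T -> Prop) p : D p -> p != 0 ->
  (forall P, fam P -> P p -> exists y, R P y) ->
  exists L : seq T, (forall y, y \in L -> exists P, [/\ fam P, P p & R P y]) /\
    (forall P, fam P -> P p -> exists2 y, y \in L & R P y).
Proof.
move=> Dp p0 HR; have [l Hl] := famF Dp p0.
have [L [HL1 HL2]] : exists L : seq T, (forall y, y \in L -> exists P, [/\ fam P, P p & R P y]) /\
    (forall P, fam P -> P p -> List.In P l -> exists2 y, y \in L & R P y).
  elim: l {Hl} => [|Q l [L [HL1 HL2]]]; first by exists [::]; split.
  have [[fQ Qp]|nQ] := pselect (fam Q /\ Q p); last first.
    by exists L; split=> // P fP Pp [EP|/(HL2 _ fP Pp)//]; case: nQ; rewrite EP.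
  have [z Rz] := HR Q fQ Qp; exists (z :: L); split.
    by move=> y; rewrite inE => /orP[/eqP->|/HL1//]; exists Q.
  move=> P fP Pp [<-|/(HL2 _ fP Pp)]; first by exists z => //; rewrite mem_head.
  by case=> y yL Ry; exists y => //; rewrite inE yL orbT.
exists L; split=> // P fP Pp; apply: HL2 => //.
have [|Q [Ql PQ]] := Hl P fP; last by have -> : P = Q by apply/predeqP.
apply: (locmax_inv hD (fam_prime fP)) => //; exact: (locmaxP hD (fam_prime fP)).
Qed.

Lemma fam_t_prime P : fam P -> t_prime D P.
Proof.
move=> fP; apply: valuation_t_prime => //; first exact: fam_prime.
by move=> x; apply: fam_valuation.
Qed.

(** Otherwise each of the finitely many members containing [x0] misses some y in [P]. Any [phi]
    multiplying [x0] and these y into [D] lies in every localization of the family, so the list has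
    v-closure containing 1, and 1 would lie in the t-ideal [P]. *)
Lemma t_prime_sub_fam P x0 : t_prime D P -> P x0 -> x0 != 0 ->
  exists2 P', fam P' & subset_of P P'.
Proof.
move=> [hP [_ tP]] Px0 x00; apply: contrapT => nex.
have Dx0 := primeA hP Px0.
have [P' fP' _|L [HL1 HL2]] := @fam_choice _ (fun P' y => P y /\ ~ P' y) _ Dx0 x00.
  apply: contrapT => nP'; apply: nex; exists P' => // y Py.
  by apply: contrapT => ?; apply: nP'; exists y.
case: tP => [P0|tP]; first by move/eqP: x00; apply; apply: P0.
apply: (prime1 hP); apply/tP; exists (x0 :: L); split; [|by rewrite /= x00|].
  by move=> y; rewrite inE => /orP[/eqP->//|/HL1[Q [_ _ []]]].
apply/(vclosure_spanE hD hK) => phi Hphi; rewrite mul1r; apply: fam_inter => P' fP'.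
have [P'x0|nP'x0] := pselect (P' x0).
  have [y yL [Py nP'y]] := HL2 _ fP' P'x0; exists (phi * y), y; split=> //.
  - by apply: Hphi; rewrite inE yL orbT.
  - exact: primeA Py.
  - by rewrite mulfK // (prime_neq0 (fam_prime fP')).
exists (phi * x0), x0; split=> //; first by apply: Hphi; rewrite mem_head.
by rewrite mulfK.
Qed.

Lemma t_prime_valuation P x0 : t_prime D P -> P x0 -> x0 != 0 ->
  forall x, x != 0 -> localization D P x \/ localization D P x^-1.
Proof.
move=> tP Px0 x00 x /(fam_valuation (P := _)) hx.
have [P' fP' PP'] := t_prime_sub_fam tP Px0 x00.
by case: (hx _ fP') => /(localization_subset PP'); [left|right].
Qed.

(** * Local structure at a prime of Lambda_0 *)

Section Lambda.
Variable P : K -> Prop.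
Hypothesis LP : Lambda0 D P.
Local Notation V := (localization D P).

Lemma Lambda_prime : prime_ideal D P. Proof. by case: LP => -[]. Qed.
Let hP := Lambda_prime.
Let hV : subring V := loc_subring hD hP.

(** Clearing denominators always puts D_P[X] inside Int(D)_P, so it is the opposite inclusion that
    fails. *)
Lemma Lambda_witness : exists f i, int_poly D f /\ ~ V f`_i.
Proof.
case: LP => _ nH; apply: contrapT => nex; apply: nH => g; split.
  move=> [f [s [If Ds nPs ->]]] i; rewrite coefZ; apply: subM => //; first exact: loc_inv.
  by apply: contrapT => nV; apply: nex; exists f, i.
move=> Vg; have [|s [Ds nPs Hs]] := @loc_common_denom _ _ hD _ hP (g : seq K).
  by move=> y /(nthP 0)[i _ <-].
exists (s *: g), s; split=> //; last by rewrite scalerA mulVf ?scale1r // (prime_neq0 hP).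
apply: int_poly_over => // i; rewrite coefZ.
have [il|il] := ltnP i (size g); first exact/Hs/mem_nth.
by rewrite nth_default // mulr0; apply: sub0.
Qed.

Lemma Lambda_nonzero : exists2 x, P x & x != 0.
Proof.
have [f [i [If nV]]] := Lambda_witness.
have [a [b [Da Db b0 E]]] := hK f`_i.
exists b => //; apply: contrapT => nPb; apply: nV; rewrite E; exists a, b; split=> //.
Qed.

Lemma Lambda_valuation x : x != 0 -> V x \/ V x^-1.
Proof.
have [x0 Px0 x00] := Lambda_nonzero; case: LP => tP _.
exact: (t_prime_valuation tP Px0 x00).
Qed.

Lemma Lambda_expr : exists2 e, (0 < e)%N & forall x, D x -> ~ P x -> P (x ^+ e - 1).
Proof.
have [f [i [If nV]]] := Lambda_witness.
(* Each x outside [P] has x^k = 1 modulo [P] for some positive k up to [size f]: otherwise all 1 -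
   x^k are units of [V], and so is x, which would bound the bad coefficient. The factorial is a
   common multiple of these k. *)
exists (size f)`!; first exact: fact_gt0.
move=> x Dx nPx.
have [k [/andP[k0 kf] Pk]] : exists k, (0 < k <= size f)%N /\ P (1 - x ^+ k).
  apply: contrapT => nex; apply: nV.
  have Vx := loc_sub hD hP Dx.
  have H : V (x ^+ (size f ^ 2) * f`_i).
    apply: coef_of_values_at_powers => //.
    + move=> k kf; have nPk : ~ P (1 - x ^+ k) by move=> ?; apply: nex; exists k.
      split; first exact: (prime_neq0 hP nPk).
      by apply: loc_inv => //; apply: subB => //; [apply: sub1|apply: subX].
    + by move=> j; apply: (loc_sub hD hP); apply: If; apply: subX.
  rewrite -(mulKf (prime_neq0 hP (s := x ^+ (size f ^ 2)) _) f`_i); last by move/(primeX hD hP Dx).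
  by apply: subM => //; apply: loc_inv => //; [apply: subX|move/(primeX hD hP Dx)].
have kd : (k %| (size f)`!)%N by rewrite dvdn_fact // k0.
rewrite -(divnK kd) mulnC exprM; apply: (ideal_expr_sub1 (A := D)).
- by case: hP.
- exact: subX.
- by rewrite -opprB; apply: (primeN hD hP).
Qed.

Lemma Lambda_maximal P' : prime_ideal D P' -> subset_of P P' -> P' = P.
Proof.
move=> hP' PP'; apply/predeqP => x; split=> [P'x|/PP'//].
have Dx := primeA hP' P'x; apply: contrapT => nPx.
have [e e0 /(_ x Dx nPx)/PP' He] := Lambda_expr.
apply: (prime1 hP'); rewrite -[1](subKr (x ^+ e)).
apply: (idealB hD) => //; first by case: hP'.
by rewrite -(prednK e0) exprS mulrC; apply: (primeMl hP') => //; apply: subX.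
Qed.

Lemma Lambda_fam : fam P.
Proof.
have [x0 Px0 x00] := Lambda_nonzero; case: LP => tP _.
have [P' fP' PP'] := t_prime_sub_fam tP Px0 x00.
by rewrite -(Lambda_maximal (fam_prime fP') PP').
Qed.

(** For [pi] in [P] all 1 - pi^k with k positive are units of [V], so the coefficient bound applies
    at powers of [pi]. *)
Lemma coef_Lambda g pi i : P pi -> (forall x, D x -> V g.[x]) ->
  V (pi ^+ (size g ^ 2) * g`_i).
Proof.
move=> Ppi Vg; have Dpi := primeA hP Ppi.
apply: coef_of_values_at_powers => //; first exact: (loc_sub hD hP).
  move=> k /andP[k0 _]; have nPk : ~ P (1 - pi ^+ k).
    move=> Pk; apply: (prime1 hP); rewrite -[1](subrK (pi ^+ k)); apply: (primeD hP) => //.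
    by rewrite -(prednK k0) exprS mulrC; apply: (primeMl hP) => //; apply: subX.
  split; first exact: (prime_neq0 hP nPk).
  by apply: loc_inv => //; apply: subB => //; [apply: sub1|apply: subX].
by move=> j; apply: Vg; apply: subX.
Qed.

Lemma Lambda_principal : exists pi, [/\ P pi, pi != 0 & forall x, P x -> V (x / pi)].
Proof.
apply: contrapT => nex.
(* As [sg] does not generate the maximal ideal, it is, up to a unit, a product x y of elements of
   [P]; the factor of smaller value has its square dividing [sg]. *)
have step sg : P sg -> sg != 0 -> exists ta, [/\ P ta, ta != 0 & V (sg / ta ^+ 2)].
  move=> Psg sg0; have [x [Px nV]] : exists x, P x /\ ~ V (x / sg).
    apply: contrapT => nx; apply: nex; exists sg; split=> // x Px.
    by apply: contrapT => ?; apply: nx; exists x.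
  have x0 : x != 0 by apply/eqP=> x0; apply: nV; rewrite x0 mul0r; apply: sub0.
  have xs0 : x / sg != 0 by rewrite mulf_neq0 ?invr_eq0.
  have [//|] := Lambda_valuation xs0; rewrite invf_div => Vsx.
  have [y [s [Py Ds nPs E]]] : locmax D P (sg / x).
    apply: contrapT => /(locmax_unit hP Vsx)[_]; rewrite invf_div; exact: nV.
  have s0 := prime_neq0 hP nPs.
  have y0 : y != 0.
    by apply/eqP=> y0; move/eqP: E; rewrite y0 mul0r mulf_eq0 invr_eq0 (negbTE sg0) (negbTE x0).
  have Es : sg = x * y / s by rewrite -mulrA -E mulrC divfK.
  have Vs := loc_inv hD Ds nPs.
  have xy0 : x / y != 0 by rewrite mulf_neq0 ?invr_eq0.
  have [Vxy|] := Lambda_valuation xy0; last rewrite invf_div => Vyx.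
    exists y; split=> //; have -> : sg / y ^+ 2 = s^-1 * (x / y) by rewrite Es; field; rewrite y0 s0.
    exact: subM.
  exists x; split=> //; have -> : sg / x ^+ 2 = s^-1 * (y / x) by rewrite Es; field; rewrite x0 s0.
  exact: subM.
have iter sg k : P sg -> sg != 0 -> exists ta, [/\ P ta, ta != 0 & V (sg / ta ^+ (2 ^ k))].
  move=> Psg sg0; elim: k => [|k [ta [Pta ta0 Vta]]].
    by exists sg; split=> //; rewrite expn0 expr1 divff //; apply: sub1.
  have [ta' [Pta' ta'0 Vta']] := step ta Pta ta0; exists ta'; split=> //.
  have -> : sg / ta' ^+ (2 ^ k.+1) = sg / ta ^+ (2 ^ k) * (ta / ta' ^+ 2) ^+ (2 ^ k).
    by rewrite expnS exprM expr_div_n mulrA divfK // expf_neq0.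
  by apply: subM => //; apply: subX.
have [f [i [If nV]]] := Lambda_witness.
pose N := (size f ^ 2)%N; set b := f`_i in nV.
have Hb pi : P pi -> V (pi ^+ N * b).
  by move=> Ppi; apply: coef_Lambda => // x Dx; apply: (loc_sub hD hP); apply: If.
have b0 : b != 0 by apply/eqP=> b0; apply: nV; rewrite b0; apply: sub0.
have [//|Vb] := Lambda_valuation b0.
have [sg [s [Psg Ds nPs E]]] : locmax D P b^-1.
  by apply: contrapT => /(locmax_unit hP Vb)[_]; rewrite invrK.
have s0 := prime_neq0 hP nPs.
have sg0 : sg != 0 by apply/eqP=> sg0; move/eqP: E; rewrite sg0 mul0r invr_eq0 (negbTE b0).
have [ta [Pta ta0 Vta]] := iter sg N Psg sg0.
(* Up to a unit [sg] is the inverse of [b]. Since ta^(2^N) divides [sg] and ta^N b lies in [V], the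
   inequality N + 1 <= 2^N puts the inverse of [ta] into [V], which is absurd. *)
have lt : (N < 2 ^ N)%N by apply: ltn_expl.
apply: (locmax_inv hD hP ta0); first exact: (locmaxP hD hP).
have -> : ta^-1 = s^-1 * (ta ^+ (2 ^ N - N.+1) * (ta ^+ N * b * (sg / ta ^+ (2 ^ N)))).
  rewrite -{2}(subnK lt) exprD exprS.
  have -> : sg = s / b by rewrite -[b]invrK E; field; rewrite s0 sg0.
  by field; rewrite ?b0 ?s0 ?ta0 ?expf_neq0.
apply: (subM hV); first exact: (loc_inv hD).
apply: (subM hV); first exact/(loc_sub hD hP)/(subX hD)/(primeA hP).
by apply: (subM hV) => //; apply: Hb.
Qed.

(** Only the members P' containing a denominator [d] of [g] matter. If P' differs from [P],
    maximality of [P] gives [pi] in [P] outside P'; a power of [pi] makes the coefficients of [g]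
    lie in [V], some [s] outside [P] brings them into [D], and [pi] is a unit at P'. The product of
    these [s] works everywhere. *)
Lemma Lambda_clear_denom g : (forall x, D x -> V g.[x]) ->
  exists s, [/\ D s, ~ P s & int_poly D (s *: g)].
Proof.
move=> Vg; have [d [Dd d0 Hd]] := poly_denom hD hK g.
pose R (P' : K -> Prop) s :=
  [/\ D s, ~ P s & forall x, D x -> localization D P' (s * g.[x])].
have [P' fP' _|L [HL1 HL2]] := @fam_choice _ R _ Dd d0.
  have hP' := fam_prime fP'.
  have [PP'|nPP'] := pselect (subset_of P P').
    rewrite (Lambda_maximal hP' PP'); exists 1; split; [exact: sub1|exact: (prime1 hP)|].
    by move=> x /Vg; rewrite mul1r.
  have [pi Ppi nP'pi] : exists2 pi, P pi & ~ P' pi.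
    by apply: contrapT => nx; apply: nPP' => x Px; apply: contrapT => ?; apply: nx; exists x.
  pose N := (size g ^ 2)%N; have Dpi := primeA hP Ppi.
  have [|s [Ds nPs Hs]] := @loc_common_denom _ _ hD _ hP [seq pi ^+ N * y | y <- (g : seq K)].
    by move=> _ /mapP[_ /(nthP 0)[i _ <-] ->]; apply: coef_Lambda.
  exists s; split=> // x Dx.
  have nPN : ~ P' (pi ^+ N) by move/(primeX hD hP' Dpi).
  exists ((s * pi ^+ N) *: g).[x], (pi ^+ N); split=> //; last 2 first.
  - exact: subX.
  - by rewrite hornerZ; field; rewrite (prime_neq0 hP').
  apply: int_poly_over => // i; rewrite coefZ -mulrA.
  have [il|il] := ltnP i (size g); first by apply/Hs/map_f/mem_nth.
  by rewrite nth_default // !mulr0; apply: sub0.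
have [|x y Dx Dy Px Py|y /HL1[P' [_ _ []]]//|Ds nPs Hs] := sub_seqM (l := L) hD (Q := fun s => ~ P s).
- exact: (prime1 hP).
- exact: (primeNM hP).
exists (\prod_(y <- L) y); split=> // x Dx; rewrite hornerZ; apply: fam_inter => P' fP'.
have hV' := loc_subring hD (fam_prime fP').
have [P'd|nP'd] := pselect (P' d).
  have [s sL [_ _ Hs']] := HL2 _ fP' P'd; have [c Dc ->] := Hs _ sL.
  rewrite -mulrA; apply: (subM hV'); last exact: Hs'.
  exact: (loc_sub hD (fam_prime fP')).
apply: (subM hV'); first exact: (loc_sub hD (fam_prime fP')).
exists (d *: g).[x], d; split=> //; last by rewrite hornerZ mulrC mulKf.
by apply: int_poly_over => // i; rewrite coefZ.
Qed.

Lemma Lambda_clear_denoms (gs : seq {poly K}) :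
  (forall g, g \in gs -> forall x, D x -> V g.[x]) ->
  exists s, [/\ D s, ~ P s & forall g, g \in gs -> int_poly D (s *: g)].
Proof.
elim: gs => [|h gs IH] H; first by exists 1; split=> //; [apply: sub1|apply: (prime1 hP)].
case: IH => [g gl|s [Ds nPs Hs]]; first by apply: H; rewrite inE gl orbT.
have [|t [Dt nPt Ht]] := @Lambda_clear_denom h; first by apply: H; rewrite mem_head.
exists (s * t); split; [exact: subM|exact: (primeNM hP)|move=> g].
rewrite inE => /orP[/eqP->|/Hs Ig]; first by rewrite -scalerA; apply: int_polyZ.
by rewrite mulrC -scalerA; apply: int_polyZ.
Qed.

(* For J = (f_1, ..., f_k) inside q, the polynomial G = prod (1 - f_i^e) is 1 modulo J while
   every f_i G takes values in P on D; hence G / pi, up to a unit of V, lies in (Int(D) : J),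
   but not in Int(D). *)
Lemma Lambda_tproper q : ideal (IntD D) q -> ~ q 1 -> (forall x, P x -> q x%:P%:F) ->
  tproper (IntD D) q.
Proof.
move=> idq q1 Pq l lq _ /(vclosure_spanE (IntD_subring hD) (IntD_qfrac hD hK)) v1.
have [qA q0 qD qM] := idq.
have [fs Ifs El] : exists2 fs, (forall f, f \in fs -> int_poly D f) & l = [seq f%:F | f <- fs].
  have: forall y, y \in l -> IntD D y by move=> y /lq/qA.
  elim: (l) => [|y k IH] H; first by exists [::].
  case: IH => [z zk|fs Ifs ->]; first by apply: H; rewrite inE zk orbT.
  have [f [If ->]] : IntD D y by apply: H; rewrite mem_head.
  by exists (f :: fs) => // g; rewrite inE => /orP[/eqP->|/Ifs].
have [pi [Ppi pi0 Vpi]] := Lambda_principal.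
have [e e0 He] := Lambda_expr.
pose G := \prod_(f <- fs) (1 - f ^+ e).
have intX f n : int_poly D f -> int_poly D (f ^+ n).
  by move=> If d Dd; rewrite horner_exp; apply/(subX hD)/If.
have int1 : int_poly D 1 by move=> d _; rewrite hornerC; apply: sub1.
have intF f : f \in fs -> int_poly D (1 - f ^+ e).
  by move=> ff; apply: int_polyB => //; apply: intX; apply: Ifs.
have IG : int_poly D G by apply: int_poly_prod.
have qG : q (1 - G)%:F.
  have: forall f, f \in fs -> q f%:F by move=> f ff; apply: lq; rewrite El map_f.
  rewrite /G; elim: (fs) Ifs => [|f ks IH] H Hq; first by rewrite big_nil subrr tofrac0.
  have If : int_poly D f by apply: H; rewrite mem_head.
  have Hk : forall g, g \in ks -> int_poly D g by move=> g gk; apply: H; rewrite inE gk orbT.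
  have {}IH : q (1 - \prod_(h <- ks) (1 - h ^+ e))%:F.
    by apply: IH => // g gk; apply: Hq; rewrite inE gk orbT.
  rewrite big_cons; move: (\prod_(_ <- _) _) IH => G' IH.
  have IG' : int_poly D G'.
    have -> : G' = 1 - (1 - G') by ring.
    by apply: int_polyB => //; apply/IntD_tofrac/qA.
  have -> : 1 - (1 - f ^+ e) * G' = (1 - G') + (G' * f ^+ e.-1) * f.
    by rewrite -mulrA -exprSr prednK //; ring.
  rewrite tofracD tofracM; apply: (qD) => //; apply: qM; last by apply: Hq; rewrite mem_head.
  by apply/IntD_tofrac; apply: int_polyM => //; apply: intX.
have DG f x : f \in fs -> D x -> P (f * G).[x].
  move=> ff Dx; have Dfx := Ifs _ ff _ Dx; rewrite hornerM.
  have [Pfx|nPfx] := pselect (P f.[x]); first by rewrite mulrC; apply: (primeMl hP) => //; apply: IG.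
  apply: (primeMl hP) => //.
  rewrite /G (big_rem f ff) /= hornerM; apply: (primeMr hP).
    by apply: int_poly_prod => // g /mem_rem; apply: intF.
  by rewrite hornerD hornerN horner_exp hornerC -opprB; apply: (primeN hD hP); apply: He.
have [|s [Ds nPs Hs]] := @Lambda_clear_denoms [seq pi^-1 *: (f * G) | f <- fs].
  by move=> _ /mapP[f ff ->] x Dx; rewrite hornerZ mulrC; apply: Vpi; apply: DG.
have /IntD_tofrac Ih : IntD D ((s / pi) *: G)%:F.
  rewrite -[_%:F]mul1r; apply: v1 => y; rewrite El => /mapP[f ff ->].
  rewrite -tofracM; apply/IntD_tofrac.
  have -> : (s / pi) *: G * f = s *: (pi^-1 *: (f * G)) by rewrite scalerA -scalerAl [f * G]mulrC.
  by apply: Hs; apply: map_f.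
have IC (c : K) : D c -> IntD D c%:P%:F by move=> Dc; apply/IntD_tofrac; apply: int_polyC.
(* Multiplying the integer-valued [(s / pi) *: G] by [pi] in [q] puts [s *: G] into [q]. As s^e = 1
   modulo [P], also [G] lies in [q], which contradicts 1 - G in [q]. *)
have qsG : q (s *: G)%:F.
  have -> : s *: G = (s / pi) *: G * pi%:P by rewrite mulrC mul_polyC scalerA mulrC divfK.
  by rewrite tofracM; apply: qM; [apply/IntD_tofrac|apply: Pq].
have qG' : q G%:F.
  have -> : G = (s ^+ e.-1)%:P * (s *: G) - G * (s ^+ e - 1)%:P.
    rewrite mul_polyC scalerA -exprSr prednK // mulrC mul_polyC scalerBl scale1r.
    by rewrite opprB addrC subrK.
  rewrite tofracB !tofracM; apply: (idealB (IntD_subring hD)) => //; apply: qM => //.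
  - by apply: IC; apply: subX.
  - exact/IntD_tofrac.
  - by apply: Pq; apply: He.
by apply: q1; rewrite -tofrac1 -[1](subrK G) tofracD; apply: qD.
Qed.

Lemma Lambda_sub_tmaximal q : ideal (IntD D) q -> ~ q 1 -> (forall x, P x -> q x%:P%:F) ->
  exists2 M, t_maximal (IntD D) M & subset_of q M.
Proof.
move=> idq q1 Pq; apply: tproper_sub_tmaximal => //.
- exact: IntD_subring.
- exact: IntD_qfrac.
- exact: Lambda_tproper.
Qed.

End Lambda.
End Krull.

(** * The two implications *)

Section KrullType.
Variables (K : fieldType) (D : K -> Prop) (fam : (K -> Prop) -> Prop).
Hypotheses (hD : subring D) (hK : forall x, qfrac D x).
Hypothesis famP : forall P, fam P -> prime_ideal D P /\ valuation_domain (localization D P).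
Hypothesis famI : forall x, D x <-> (qfrac D x /\ forall P, fam P -> localization D P x).
Hypothesis famF : forall x, D x -> x != 0 -> exists l : seq (K -> Prop), forall P, fam P ->
  ~ localization D P x^-1 -> exists Q, List.In Q l /\ (forall y, P y <-> Q y).

Local Notation Int := (IntD D).
Local Notation Int0 := (IntD (D0 D)).
Let hI : subring Int := IntD_subring hD.

(** * The overring D_0, and the passage from PvMD to Prüfer *)

Lemma D_sub_D0 x : D x -> D0 D x.
Proof. by move=> Dx; split=> // P LP; exact: (loc_sub hD (Lambda_prime LP)). Qed.

Lemma D0_subring : subring (D0 D).
Proof.
split; [exact/D_sub_D0/(sub0 hD)|exact/D_sub_D0/(sub1 hD)| |].
  move=> x y [_ Hx] [_ Hy]; split=> // P LP.
  by apply: (subB (loc_subring hD (Lambda_prime LP))); [apply: Hx|apply: Hy].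
move=> x y [_ Hx] [_ Hy]; split=> // P LP.
by apply: (subM (loc_subring hD (Lambda_prime LP))); [apply: Hx|apply: Hy].
Qed.
Let h0 := D0_subring.

Lemma D0_qfrac x : qfrac (D0 D) x.
Proof.
have [a [b [Da Db b0 ->]]] := hK x.
by exists a, b; split=> //; apply: D_sub_D0.
Qed.

Lemma IntD_sub_IntD0 y : Int y -> Int0 y.
Proof.
move=> [f [If ->]]; apply/IntD_tofrac => x [_ Hx]; split=> // P LP.
apply: int_poly_localization (Lambda_prime LP) _ (Hx _ LP) => // z Dz.
apply: (loc_sub hD (Lambda_prime LP)); exact: If.
Qed.

Lemma IntD0_clear_denom P f : Lambda0 D P -> int_poly (D0 D) f ->
  exists s, [/\ D s, ~ P s & int_poly D (s *: f)].
Proof.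
move=> LP If; apply: (Lambda_clear_denom hD hK famP famI famF LP) => x Dx.
by have [_] := If _ (D_sub_D0 Dx); apply.
Qed.

(* X / d or its inverse lies in the localization of Int(D) at a t-maximal ideal containing
   {f | f(0) in P}; this gives f in Int(D) with f'(0) in d^-1 V^*, and f'(0) is bounded in V. *)
Lemma PvMD_Lambda_rank1 P pi d : PvMD Int -> Lambda0 D P -> P pi -> D d -> d != 0 ->
  exists N, localization D P (pi ^+ N / d).
Proof.
move=> pvmd LP Ppi Dd d0.
have hP := Lambda_prime LP; have hV := loc_subring hD hP.
pose q y := exists f, [/\ int_poly D f, P f.[0] & y = f%:F].
have [|q1|x Px|M tM qM] := Lambda_sub_tmaximal hD hK famP famI famF LP (q := q).
- split.
  + by move=> _ [f [If _ ->]]; apply/IntD_tofrac.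
  + exists 0; rewrite horner0 tofrac0; split=> //; last exact: prime0 hP.
    by move=> x _; rewrite horner0; apply: sub0.
  + move=> _ _ [f [If Pf ->]] [g [Ig Pg ->]]; exists (f + g); rewrite tofracD hornerD.
    split=> //; last exact: (primeD hP).
    by move=> x Dx; rewrite hornerD; apply: (subD hD); [apply: If|apply: Ig].
  + move=> _ _ [h [Ih ->]] [f [If Pf ->]]; exists (h * f); rewrite tofracM hornerM.
    split=> //; first exact: int_polyM.
    by apply: (primeMl hP) => //; apply: Ih; exact: sub0.
- case: q1 => f [_ Pf /eqP]; rewrite -tofrac1 tofrac_eq => /eqP E.
  by apply: (prime1 hP); rewrite -E hornerC in Pf.
- by exists x%:P; rewrite hornerC; split=> //; apply: int_polyC; exact: (primeA hP).
have [[[MA M0 MD MM] _] M1 _] := tM.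
have Xd0 : 'X%:F / d%:P%:F != 0 :> {fraction {poly K}}.
  by rewrite mulf_neq0 ?invr_eq0 ?tofrac_eq0 ?polyC_eq0 ?polyX_eq0.
have cross f g (a b : {poly K}) : b != 0 -> ~ M g%:F -> a%:F / b%:F = f%:F / g%:F -> a * g = f * b.
  move=> b0 nMg /eqP; rewrite eqr_div ?tofrac_eq0 //.
    by rewrite -!tofracM tofrac_eq => /eqP.
  by apply/eqP=> g0; apply: nMg; rewrite g0 tofrac0.
have [] := pvmd _ tM _ (localization_qfrac hI M1 (IntD_qfrac hD hK _)) Xd0.
  (* Case X/d = f/g: comparing coefficients of degree 1 in X g = d f gives g(0) = d f_1, and g(0) is
     outside [P] because [g] is outside [M]. *)
  move=> [_ [_ [[f [If ->]] [g [Ig ->]] nMg]]].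
  move/cross => /(_ _ nMg); rewrite polyC_eq0 => /(_ d0) E.
  have nPg : ~ P g`_0 by move=> Pg; apply/nMg/qM; exists g; rewrite horner_coef0.
  have Dg : D g`_0 by rewrite -horner_coef0; apply: Ig; exact: sub0.
  have Eg : g`_0 = f`_1 * d by have := congr1 (fun p : {poly K} => p`_1) E; rewrite coefXM coefMC.
  exists (size f ^ 2)%N.
  have -> : pi ^+ (size f ^ 2) / d = (g`_0)^-1 * (pi ^+ (size f ^ 2) * f`_1).
    have g00 := prime_neq0 hP nPg; apply: (mulfI g00); rewrite mulVKf // [in LHS]Eg.
    by field.
  apply: (subM hV); first exact: loc_inv.
  apply: (coef_Lambda hD LP) => // x Dx; apply: (loc_sub hD hP); exact: If.
(* Case d/X = f/g: then g(0) = 0, so [g] would lie in [q] and hence in [M]. *)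
rewrite invf_div => -[_ [_ [[f [If ->]] [g [Ig ->]] nMg]]].
move/cross => /(_ _ nMg); rewrite polyX_eq0 => /(_ isT) E.
case: nMg; apply: qM; exists g; split=> //.
have /eqP := congr1 (horner^~ 0) E; rewrite !hornerE mulf_eq0 (negbTE d0) /= => /eqP->.
exact: prime0 hP.
Qed.

(** If no such P existed, each P of Lambda_0 containing [p] would miss some y in [J], and 1 - y^e
    would lie in P while being 1 modulo [J]. The product [Z] of these elements lies in all such P
    and is 1 modulo [J]; rank one makes a power of [Z] a multiple of [p] in D_0, hence an element of
    [J], so [J] would contain 1. *)
Lemma PvMD_Lambda_above N p : PvMD Int -> ideal Int0 N -> ~ N 1 -> D p -> p != 0 -> N p%:P%:F ->
  exists2 P, Lambda0 D P & forall x, D x -> N x%:P%:F -> P x.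
Proof.
move=> pvmd idN N1 Dp p0 Np; apply: contrapT => nex.
pose J c := N c%:P%:F; have idJ : ideal (D0 D) J by apply: ideal_constants.
have [J0A J00 JD JM] := idJ.
have J1 : ~ J 1 by rewrite /J tofrac1.
have D01 := sub1 h0.
pose R P z := [/\ D z, J (1 - z) & Lambda0 D P -> P z].
have [P fP Pp|L [HL1 HL2]] := fam_choice hD famP famF (R := R) Dp p0.
  have [LP|nLP] := pselect (Lambda0 D P); last first.
    by exists 1; split=> //; [exact: sub1|rewrite subrr].
  have [y [Dy Jy nPy]] : exists y, [/\ D y, J y & ~ P y].
    apply: contrapT => nx; apply: nex; exists P => // x Dx Jx.
    by apply: contrapT => ?; apply: nx; exists x.
  have [e e0 He] := Lambda_expr hD LP.
  have D1e : D (1 - y ^+ e) by apply: subB => //; [apply: sub1|apply: subX].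
  exists (1 - y ^+ e); split=> // [|_].
    rewrite subKr -(prednK e0) exprS mulrC; apply: JM => //; apply: D_sub_D0; exact: subX.
  by rewrite -opprB; apply: (primeN hD (Lambda_prime LP)); apply: He.
have [|x y Dx Dy Jx Jy|y /HL1[P [_ _ []]]//|DZ JZ HZ] := sub_seqM (l := L) hD (Q := fun z => J (1 - z)).
- by rewrite subrr.
- have -> : 1 - x * y = (1 - x) + x * (1 - y) by ring.
  by apply: JD => //; apply: JM => //; apply: D_sub_D0.
set Z := \prod_(y <- L) y in DZ JZ HZ.
pose R' P n := Lambda0 D P -> localization D P (Z ^+ n / p).
have [P fP Pp|L' [_ HL']] := fam_choice hD famP famF (R := R') Dp p0.
  have [LP|nLP] := pselect (Lambda0 D P); last by exists 0%N.
  have [z zL [_ _ /(_ LP) Pz]] := HL2 _ fP Pp.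
  have [c Dc EZ] := HZ _ zL.
  have PZ : P Z by rewrite EZ; apply: (primeMl (Lambda_prime LP)).
  by have [n Hn] := PvMD_Lambda_rank1 pvmd LP PZ Dp p0; exists n.
(* The sum dominates every local exponent. *)
pose n := (\sum_(k <- L') k)%N.
have D0Z : D0 D (Z ^+ n / p).
  split=> // P LP; have hP := Lambda_prime LP.
  have fP := Lambda_fam hD hK famP famI famF LP.
  have [Pp|nPp] := pselect (P p); last by exists (Z ^+ n), p; split=> //; apply: subX.
  have [k kL /(_ LP) Vk] := HL' _ fP Pp.
  have kn : (k <= n)%N by rewrite /n (big_rem k kL) leq_addr.
  rewrite -(subnK kn) exprD -mulrA; apply: (subM (loc_subring hD hP)) => //.
  apply: (loc_sub hD hP); exact: subX.
have JZn : J (Z ^+ n) by rewrite -(divfK p0 (Z ^+ n)); apply: JM.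
apply: J1; rewrite -[1](subKr (Z ^+ n)); apply: (idealB h0) => //.
apply: (ideal_expr_sub1 _ idJ); first exact: D_sub_D0.
by rewrite -opprB; apply: (idealN h0).
Qed.

Lemma PvMD_Int_Prufer_Int0 : PvMD Int -> Prufer Int0.
Proof.
move=> pvmd N maxN y _ y0.
have hN := maximal_prime (IntD_subring h0) maxN.
have [idN N1 _] := maxN; have [NA N0 ND NM] := idN.
pose J c := N c%:P%:F; have idJ : ideal (D0 D) J by apply: ideal_constants.
have [J0A J00 JD JM] := idJ.
(* A nonzero element of D_0 in [J] has a nonzero multiple in [D], so if [J] meets [D] only in 0, it
   is zero and coprime fractions suffice. *)
have [[p [Dp p0 Np]]|nex] := pselect (exists p, [/\ D p, p != 0 & J p]); last first.
  apply: valuation_trivial_contraction => //; first exact: D0_qfrac.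
  move=> d _ Nd; apply/eqP; apply: contrapT => d0; apply: nex.
  have [a [b [Da Db b0 E]]] := hK d; exists a; split=> //.
    by apply/eqP=> a0; apply: d0; rewrite E a0 mul0r.
  have -> : a = b * d by rewrite E mulrC divfK.
  by apply: JM => //; apply: D_sub_D0.
have [P LP HP] := PvMD_Lambda_above pvmd idN N1 Dp p0 Np.
have hP := Lambda_prime LP.
have D0N x z : D0 D x -> D0 D z -> J (x * z) -> J x \/ J z.
  move=> Dx Dz; rewrite /J polyCM tofracM => H.
  by apply: (prime_memM hN _ _ H); apply/IntD_tofrac; apply: int_polyC.
(* By rank one some s x^n with s outside [P] is a multiple of [p], hence in the prime [J]; since
   elements of [J] in [D] lie in [P], s is not in [J], so x is. *)
have PJ x : P x -> J x.
  move=> Px; have Dx := primeA hP Px.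
  have [n [a [s [Da Ds nPs E]]]] := PvMD_Lambda_rank1 pvmd LP Px Dp p0.
  have Js : J (s * x ^+ n).
    have -> : s * x ^+ n = a * p.
      by rewrite -(divfK p0 (x ^+ n)) E; field; rewrite (prime_neq0 hP).
    by apply: JM => //; apply: D_sub_D0.
  have [/(HP _ Ds)//|] := D0N _ _ (D_sub_D0 Ds) (D_sub_D0 (subX hD n Dx)) Js.
  elim: n {E Js} => [|n IH]; first by rewrite expr0 /J polyC1 tofrac1 => /N1.
  by rewrite exprS => /(D0N _ _ (D_sub_D0 Dx) (D_sub_D0 (subX hD n Dx)))[].
pose q z := Int z /\ N z.
have [||x Px|M tM qM] := Lambda_sub_tmaximal hD hK famP famI famF LP (q := q).
- split.
  + by move=> z [].
  + by split=> //; apply: sub0.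
  + by move=> u v [Iu Nu] [Iv Nv]; split; [apply: subD|apply: ND].
  + by move=> a z Ia [Iz Nz]; split; [apply: subM|apply/NM/Nz/IntD_sub_IntD0].
- by case.
- by split; [apply/IntD_tofrac; apply: int_polyC => //; apply: (primeA hP)|apply: PJ].
have [[[MA M0 MD MM] _] M1 _] := tM.
(* The contraction [q] of [N] lies in [M], so the localization at [N] contains the valuation domain
   at [M]. *)
have sub z : localization Int M z -> localization Int0 N z.
  move=> [a [b [Ia Ib nMb ->]]]; exists a, b; split=> //; [exact: IntD_sub_IntD0|exact: IntD_sub_IntD0|].
  by move=> Nb; apply/nMb/qM.
by case: (pvmd _ tM y (localization_qfrac hI M1 (IntD_qfrac hD hK _)) y0) => /sub; [left|right].
Qed.

(** * The passage from Prüfer to PvMD *)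

Lemma Prufer_Int0_valuation_over_Lambda P M y : Prufer Int0 -> Lambda0 D P -> ideal Int M ->
  (forall x, D x -> M x%:P%:F -> P x) -> y != 0 ->
  localization Int M y \/ localization Int M y^-1.
Proof.
move=> pru LP [MA M0 MD MM] MP y0; have hP := Lambda_prime LP.
have IC (c : K) : D c -> Int c%:P%:F by move=> Dc; apply/IntD_tofrac; apply: int_polyC.
have clear z : Int0 z -> exists s, [/\ D s, ~ P s & Int (s%:P%:F * z)].
  move=> [f [If ->]]; have [s [Ds nPs Is]] := IntD0_clear_denom LP If.
  by exists s; split=> //; rewrite -tofracM mul_polyC; apply/IntD_tofrac.
(* The elements of Int(D_0) that a constant outside [P] carries into [M]. They form an ideal because
   such constants carry Int(D_0) into Int(D), and a proper one because the constants of [D] in [M]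
   lie in [P]. *)
pose n z := Int0 z /\ exists s, [/\ D s, ~ P s & M (s%:P%:F * z)].
have idn : ideal Int0 n.
  split.
  - by move=> z [].
  - split; first exact: (sub0 (IntD_subring h0)).
    by exists 1; rewrite mulr0; split=> //; [apply: sub1|apply: (prime1 hP)].
  - move=> u v [Iu [s [Ds nPs Ms]]] [Iv [t [Dt nPt Mt]]].
    split; first exact: (subD (IntD_subring h0)).
    exists (s * t); split; [exact: subM|exact: (primeNM hP)|].
    rewrite polyCM tofracM.
    have -> : s%:P%:F * t%:P%:F * (u + v) =
      t%:P%:F * (s%:P%:F * u) + s%:P%:F * (t%:P%:F * v) by ring.
    by apply: MD; apply: MM => //; apply: IC.
  - move=> h z Ih [Iz [s [Ds nPs Ms]]].
    split; first exact: (subM (IntD_subring h0)).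
    have [t [Dt nPt It]] := clear _ Ih.
    exists (t * s); split; [exact: subM|exact: (primeNM hP)|].
    rewrite polyCM tofracM.
    have -> : t%:P%:F * s%:P%:F * (h * z) = (t%:P%:F * h) * (s%:P%:F * z) by ring.
    exact: MM.
have n1 : ~ n 1 by move=> [_ [s [Ds nPs]]]; rewrite mulr1 => /MP; apply: contra_not nPs; apply.
have [N maxN nN] := ideal_sub_maximal idn n1.
have [_ N1 _] := maxN.
have sub z : localization Int0 N z -> localization Int M z.
  move=> [a [b [Ia Ib nNb ->]]].
  have [s [Ds nPs Is]] := clear _ Ia; have [t [Dt nPt It]] := clear _ Ib.
  exists (t%:P%:F * (s%:P%:F * a)), (s%:P%:F * (t%:P%:F * b)).
  split.
  - by apply: (subM hI) => //; apply: IC.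
  - by apply: (subM hI) => //; apply: IC.
  - move=> Mst; apply/nNb/nN; split=> //; exists (s * t); split; [exact: subM|exact: (primeNM hP)|].
    by rewrite polyCM tofracM -mulrA.
  - have b0 : b != 0.
      apply/eqP=> b0; apply/nNb/nN; rewrite b0; by have [_ H _ _] := idn.
    have cancel (F : fieldType) (u v a' b' : F) : u != 0 -> v != 0 -> b' != 0 ->
        a' / b' = v * (u * a') / (u * (v * b')) by move=> *; field; apply/and3P.
    have nz c : ~ P c -> c%:P%:F != 0 by move=> /(prime_neq0 hP); rewrite tofrac_eq0 polyC_eq0.
    exact: (cancel _ _ _ _ _ (nz _ nPs) (nz _ nPt) b0).
have qy := localization_qfrac (IntD_subring h0) N1 (IntD_qfrac h0 D0_qfrac y).
by case: (pru _ maxN y qy y0) => /sub; [left|right].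
Qed.

Lemma not_Lambda_int_poly P : fam P -> ~ Lambda0 D P ->
  forall g, IntD_loc D P g <-> poly_over_loc D P g.
Proof.
move=> fP nLP; apply: contrapT => H; apply: nLP; split=> //.
exact: (fam_t_prime hD hK famP).
Qed.

Lemma valuation_Gauss_extension P y : fam P -> ~ Lambda0 D P -> y != 0 ->
  exists f g, [/\ int_poly D f, int_poly D g, exists i, ~ locmax D P g`_i &
    y = f%:F / g%:F \/ y^-1 = f%:F / g%:F].
Proof.
move=> fP nLP y0; have Hloc := not_Lambda_int_poly fP nLP.
have hP := fam_prime famP fP; have hV := loc_subring hD hP.
have V0 := sub0 hV.
have main (a b : {poly K}) z : z \in (b : seq K) -> z != 0 ->
    (forall w, w \in (a : seq K) -> localization D P (w / z)) ->
    (forall w, w \in (b : seq K) -> localization D P (w / z)) ->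
    exists f g, [/\ int_poly D f, int_poly D g, exists i, ~ locmax D P g`_i &
    a%:F / b%:F = f%:F / g%:F].
  move=> zb z0 Ha Hb.
  have sc (c : {poly K}) : (forall w, w \in (c : seq K) -> localization D P (w / z)) ->
      IntD_loc D P (z^-1 *: c).
    move=> Hc; apply/Hloc => i; rewrite coefZ mulrC.
    have [il|il] := ltnP i (size c); first exact/Hc/mem_nth.
    by rewrite nth_default // mul0r.
  have [f [s [If Ds nPs Ef]]] := sc _ Ha; have [g [t [Ig Dt nPt Eg]]] := sc _ Hb.
  have s0 := prime_neq0 hP nPs; have t0 := prime_neq0 hP nPt.
  (* Division by [z], a coefficient of least value, brings both polynomials into D_P[X] = Int(D)_P,
     and s t clears the two denominators. The coefficient [z] of [b] becomes s t, outside [P]. *)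
  exists ((s * t / z) *: a), ((s * t / z) *: b).
  have Ea : (s * t / z) *: a = t *: f.
    by rewrite -scalerA Ef scalerA mulrAC divff // mul1r.
  have Eb : (s * t / z) *: b = s *: g.
    by rewrite -scalerA Eg scalerA -mulrA divff // mulr1.
  split.
  - by rewrite Ea; apply: int_polyZ.
  - by rewrite Eb; apply: int_polyZ.
  - exists (index z b); rewrite coefZ nth_index // divfK // => /(locmaxA hP (subM hD Ds Dt)).
    exact: (primeNM hP).
  - by rewrite -!mul_polyC tofrac_div_cancel // polyC_eq0 !mulf_neq0 // invr_eq0.
have [a [b [b0 _ Ey]]] := frac_coprime y.
have hv x : x != 0 -> localization D P x \/ localization D P x^-1.
  exact: (fam_valuation hD hK famP).
have nz : has (fun w => w != 0) ((a : seq K) ++ b).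
  rewrite has_cat; apply/orP; right; apply/hasP; exists (lead_coef b).
    by rewrite lead_coefE mem_nth // prednK // lt0n size_poly_eq0.
  by rewrite lead_coef_eq0.
have [z [zl z0 Hz]] := valuation_divisor hV hv nz.
have Ha w : w \in (a : seq K) -> localization D P (w / z) by move=> h; apply: Hz; rewrite mem_cat h.
have Hb w : w \in (b : seq K) -> localization D P (w / z) by move=> h; apply: Hz; rewrite mem_cat h orbT.
move: zl; rewrite mem_cat => /orP[za|zb].
  have [f [g [If Ig Hg E]]] := main b a z za z0 Hb Ha.
  by exists f, g; split=> //; right; rewrite Ey invf_div.
have [f [g [If Ig Hg E]]] := main a b z zb z0 Ha Hb.
by exists f, g; split=> //; left; rewrite Ey.
Qed.

Lemma Prufer_Int0_PvMD_Int : Prufer Int0 -> PvMD Int.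
Proof.
move=> pru M tM y _ y0.
have [[idM _] M1 _] := tM; have [MA M0 MD MM] := idM.
have [[p [Dp p0 Mp]]|nex] := pselect (exists p, [/\ D p, p != 0 & M p%:P%:F]); last first.
  apply: valuation_trivial_contraction => // d Dd Md.
  by apply/eqP; apply: contrapT => /negP d0; apply: nex; exists d.
apply: contrapT => nval.
(* The element [z] of [M] certifies the condition at [P]. *)
pose R P z := M z /\ forall phi : {poly K}, Int (phi%:F * z) -> Int (phi%:F * p%:P%:F) ->
  forall x, D x -> localization D P phi.[x].
have [P fP Pp|L [HL1 HL2]] := fam_choice hD famP famF (R := R) Dp p0.
  have hP := fam_prime famP fP.
  have [LP|nLP] := pselect (Lambda0 D P).
    have [x [Dx Mx nPx]] : exists x, [/\ D x, M x%:P%:F & ~ P x].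
      apply: contrapT => nx; apply: nval.
      apply: (Prufer_Int0_valuation_over_Lambda pru LP) => // x Dx Mx.
      by apply: contrapT => ?; apply: nx; exists x.
    exists x%:P%:F; split=> // phi; rewrite -tofracM => /IntD_tofrac Iphi _ d Dd.
    exists (phi.[d] * x), x; split=> //; last by rewrite mulfK // (prime_neq0 hP).
    by have := Iphi d Dd; rewrite hornerM hornerC.
  have Hloc := not_Lambda_int_poly fP nLP.
  have Iloc f : int_poly D f -> poly_over_loc D P f.
    move=> If; apply/Hloc; exists f, 1; rewrite invr1 scale1r; split=> //; first exact: sub1.
    exact: (prime1 hP).
  (* Otherwise every denominator with a unit coefficient at [P] avoids [M], and the Gauss extension
     decides [y]. Such an [f] certifies the condition by Gauss's lemma. *)
  have [f [If Mf cf]] : exists f, [/\ int_poly D f, M f%:F & exists i, ~ locmax D P f`_i].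
    apply: contrapT => nf; apply: nval.
    have [f [g [If Ig cg E]]] := valuation_Gauss_extension fP nLP y0.
    have nMg : ~ M g%:F by move=> Mg; apply: nf; exists g.
    by case: E => ->; [left|right]; exists f%:F, g%:F; split=> //; apply/IntD_tofrac.
  exists f%:F; split=> // phi; rewrite -tofracM => /IntD_tofrac/Iloc Vphif _ x Dx.
  apply: (sub_horner (loc_subring hD hP)); last exact: (loc_sub hD hP).
  apply: (gauss_div hD hP _ (Iloc _ If) cf Vphif) => z z0.
  exact: (fam_valuation hD hK famP).
apply: (tmaximal_tclosed (l := p%:P%:F :: L) tM).
- by move=> z; rewrite inE => /orP[/eqP->//|/HL1[P [_ _ []]]].
- by rewrite /= tofrac_eq0 polyC_eq0 p0.
- apply/(vclosure_spanE hI (IntD_qfrac hD hK)) => phi Hphi; rewrite mul1r.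
  have [h [Ih Eh]] : Int (phi * p%:P%:F) by apply: Hphi; rewrite mem_head.
  (* Having [p] in the list makes [phi] a polynomial over K whose values on [D] can be bad only at
     the members containing [p], where a certificate is available. *)
  have Ephi : phi = (p^-1 *: h)%:F.
    apply: (mulIf (x := p%:P%:F)); first by rewrite tofrac_eq0 polyC_eq0.
    by rewrite Eh -tofracM mulrC mul_polyC scalerA divff // scale1r.
  rewrite Ephi in Hphi *; apply/IntD_tofrac => x Dx.
  have Hp := Hphi _ (mem_head _ _).
  apply: (fam_inter hK famI) => P fP; have hP := fam_prime famP fP.
  have [Pp|nPp] := pselect (P p); last first.
    by exists h.[x], p; split=> //; [apply: Ih|rewrite hornerZ mulrC].
  have [z zL [Mz Hz]] := HL2 _ fP Pp.
  by apply: Hz => //; apply: Hphi; rewrite inE zL orbT.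
Qed.

End KrullType.

Theorem theorem3p1 (K : fieldType) (D : K -> Prop)
  (hD : subring D) (hK : forall x : K, qfrac D x) (hkt : krull_type D) :
  PvMD (IntD D) <-> Prufer (IntD (D0 D)).
Proof.
case: hkt => fam [famP famI famF]; split.
  exact: (PvMD_Int_Prufer_Int0 hD hK famP famI famF).
exact: (Prufer_Int0_PvMD_Int hD hK famP famI famF).
Qed.
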